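(* Let $N$ be a $4$-dimensional Riemannian space form of constant sectional curvature $L_0$, $M$ a Riemann surface and $F:M\to N$ a conformal immersion whose normal connection $\nabla^{\perp}$ is flat. Let $K$ be the curvature of the induced metric $g$. (a) Suppose that $K$ is nowhere equal to $L_0$. Then on a neighborhood of each point of $M$, $F$ has a parallel normal vector field if and only if the second fundamental form $\sigma$ of $F$ satisfies the linearly dependent condition, i.e. there is a function $\theta$ of $(u,v)$ with $$\cos\theta\,(\alpha_1,\alpha_2,\alpha_3)+\sin\theta\,(\beta_1,\beta_2,\beta_3)=(0,0,0).$$ In addition, if one of these conditions holds, then $\gamma+\theta$ is constant. (b) Suppose $K\equiv L_0$. Then on a neighborhood of each point of $M$, $F$ has a parallel normal vector field if and only if $\sigma$ satisfies the linearly dependent condition with a function $\theta$ such that $\gamma+\theta$ is constant. If $F$ has a parallel normal vector field, then, normalized to unit length, it is given by $e^{-\lambda}(\cos\theta\,N_1+\sin\theta\,N_2)$, with $\theta$ a function as in (a), respectively (b).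
   Context: All objects are smooth. $h$ is the metric of $N$, $\nabla$ its Levi-Civita connection. Everything is local: $(u,v)$ are isothermal coordinates of $M$ compatible with its complex structure on a simply connected domain; $g=e^{2\lambda}(du^2+dv^2)$; $T_1=dF(\partial_u)$, $T_2=dF(\partial_v)$; $N_1,N_2$ are normal vector fields of $F$ with $h(N_1,N_1)=h(N_2,N_2)=e^{2\lambda}$, $h(N_1,N_2)=0$. The real functions $\alpha_k,\beta_k$ ($k=1,2,3$) and $\mu_1,\mu_2$ are defined by: the normal components of $\nabla_{T_1}T_1$, $\nabla_{T_1}T_2$, $\nabla_{T_2}T_2$ are $\alpha_1N_1+\beta_1N_2$, $\alpha_2N_1+\beta_2N_2$, $\alpha_3N_1+\beta_3N_2$ respectively; and $\nabla^{\perp}_{T_1}N_1=\lambda_uN_1+\mu_1N_2$, $\nabla^{\perp}_{T_1}N_2=-\mu_1N_1+\lambda_uN_2$, $\nabla^{\perp}_{T_2}N_1=\lambda_vN_1+\mu_2N_2$, $\nabla^{\perp}_{T_2}N_2=-\mu_2N_1+\lambda_vN_2$, where $\nabla^{\perp}$ is the normal connection (normal component of $\nabla$). Flatness of $\nabla^{\perp}$ means that its curvature tensor $R^{\perp}$ vanishes, equivalently $(\mu_1)_v=(\mu_2)_u$; $\gamma$ then denotes a function with $\gamma_u=\mu_1$, $\gamma_v=\mu_2$. A parallel normal vector field is a nowhere zero normal vector field $\xi$ of $F$ with $\nabla\xi=0$ for the Levi-Civita connection $\nabla$ of $N$ (not only for $\nabla^{\perp}$). *)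

(* Defs.v *)
From HB Require Import structures.
From mathcomp Require Import all_boot all_order all_algebra.
From mathcomp Require Import all_classical all_reals all_analysis.

Set Implicit Arguments.
Unset Strict Implicit.
Unset Printing Implicit Defensive.

Import Order.TTheory GRing.Theory Num.Theory.
Import numFieldNormedType.Exports.

Local Open Scope classical_set_scope.
Local Open Scope ring_scope.

Definition partial (R : realType) (m : nat) (W : normedModType R) (k : 'I_m)
    (f : 'rV[R]_m -> W) : 'rV[R]_m -> W :=
  fun x => 'D_(delta_mx 0 k) f x.

Fixpoint class_C (R : realType) (m : nat) (W : normedModType R) (r : nat)
    (U : set 'rV[R]_m) (f : 'rV[R]_m -> W) : Prop :=
  match r with
  | 0 => forall x, U x -> {for x, continuous f}
  | r'.+1 => (forall x, U x -> differentiable f x) /\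
             (forall k, class_C r' U (partial k f))
  end.

(* Only used for open U. *)
Definition smooth (R : realType) (m : nat) (W : normedModType R)
    (U : set 'rV[R]_m) (f : 'rV[R]_m -> W) : Prop :=
  forall r, class_C r U f.

Definition simply_connected (R : realType) (T : topologicalType) (D : set T) :
    Prop :=
  let I : set R := `[0, 1]%classic in
  (forall x y, D x -> D y -> exists c : R -> T,
     [/\ {within I, continuous c}, c @` I `<=` D, c 0 = x & c 1 = y]) /\
  (forall c : R -> T,
     {within I, continuous c} -> c @` I `<=` D -> c 0 = c 1 ->
     exists H : R * R -> T,
     [/\ {within I `*` I, continuous H}, H @` (I `*` I) `<=` D,
         forall t, I t -> H (t, 0) = c t,
         forall t, I t -> H (t, 1) = c 0 &
         forall s, I s -> H (0, s) = c 0 /\ H (1, s) = c 0]).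

(* A smooth n-manifold, given by an atlas that need not be maximal:
   [coord i : dom i -> R^n] is a chart with inverse [param i]. *)
Record manifold (R : realType) (n : nat) := Manifold {
  carrier :> topologicalType;
  manifold_hausdorff : hausdorff_space carrier;
  manifold_second_countable : @second_countable carrier;
  chart : Type;
  dom : chart -> set carrier;
  coord : chart -> carrier -> 'rV[R]_n;
  param : chart -> 'rV[R]_n -> carrier;
  dom_open : forall i, open (dom i);
  dom_cover : forall x, exists i, dom i x;
  image_open : forall i, open (coord i @` dom i);
  coordK : forall i x, dom i x -> param i (coord i x) = x;
  coord_continuous : forall i x, dom i x -> {for x, continuous (coord i)};
  param_continuous : forall i y,
    (coord i @` dom i) y -> {for y, continuous (param i)};
  trans_smooth : forall i j,
    smooth (coord i @` (dom i `&` dom j)) (coord j \o param i)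
}.

Definition dot (R : realType) (n : nat) (G : 'M[R]_n) (v w : 'rV[R]_n) : R :=
  (v *m G *m w^T) 0 0.

(* [metric i y] is the matrix of the metric in the chart i, at the point with
   coordinates y. *)
Record riemannian_metric (R : realType) (n : nat) (N : manifold R n) :=
  RiemannianMetric {
  metric :> chart N -> 'rV[R]_n -> 'M[R]_n;
  metric_smooth : forall i, smooth (coord i @` dom i) (metric i);
  metric_sym : forall i x, dom i x ->
    (metric i (coord i x))^T = metric i (coord i x);
  metric_pos : forall i x v, dom i x -> v != 0 ->
    0 < dot (metric i (coord i x)) v v;
  metric_compat : forall i j x v w, dom i x -> dom j x ->
    dot (metric j (coord j x))
        ('d (coord j \o param i) (coord i x) v)
        ('d (coord j \o param i) (coord i x) w) =
    dot (metric i (coord i x)) v w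
}.

(* The Levi-Civita connection and the sectional curvature of the metric
   G = (G_ab) on an open subset of R^n. *)
Section coordinate_geometry.
Variables (R : realType) (n : nat) (G : 'rV[R]_n -> 'M[R]_n).

(* Gamma^c_ab *)
Definition christoffel (a b c : 'I_n) (x : 'rV[R]_n) : R :=
  2^-1 * \sum_d invmx (G x) c d *
    (partial a (fun y => (G y b d : R)) x + partial b (fun y => (G y a d : R)) x
     - partial d (fun y => (G y a b : R)) x).

Definition connection_form (x v w : 'rV[R]_n) : 'rV[R]_n :=
  \row_c \sum_a \sum_b christoffel a b c x * v 0 a * w 0 b.

(* R(d_a, d_b) d_c = sum_d (curvature_coef a b c d) d_d, with the convention
   R(X, Y) = [nabla_X, nabla_Y] - nabla_[X, Y]. *)
Definition curvature_coef (a b c d : 'I_n) (x : 'rV[R]_n) : R :=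
  partial a (christoffel b c d) x - partial b (christoffel a c d) x
  + \sum_e (christoffel b c e x * christoffel a e d x
            - christoffel a c e x * christoffel b e d x).

Definition curvature (x X Y Z : 'rV[R]_n) : 'rV[R]_n :=
  \row_d \sum_a \sum_b \sum_c curvature_coef a b c d x * X 0 a * Y 0 b * Z 0 c.

Definition sectional_curvature (x X Y : 'rV[R]_n) : R :=
  dot (G x) (curvature x X Y Y) X /
  (dot (G x) X X * dot (G x) Y Y - dot (G x) X Y ^+ 2).

End coordinate_geometry.

Definition constant_curvature (R : realType) (n : nat) (N : manifold R n)
    (h : riemannian_metric N) (L0 : R) : Prop :=
  forall i x (X Y : 'rV[R]_n), dom i x -> row_free (col_mx X Y) ->
    sectional_curvature (h i) (coord i x) X Y = L0.

Definition uu : 'I_2 := ord0.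
Definition vv : 'I_2 := ord_max.

(* Immersions F : D -> N of a domain D of the (u, v)-plane. A vector along F is
   given by its components in each chart of N. *)
Section surfaces.
Variables (R : realType) (n : nat) (N : manifold R n) (h : riemannian_metric N).
Variable F : 'rV[R]_2 -> N.

Definition field := chart N -> 'rV[R]_2 -> 'rV[R]_n.

Definition in_charts (U : set 'rV[R]_2) (P : chart N -> 'rV[R]_2 -> Prop) :=
  forall i p, U p -> dom i (F p) -> P i p.

Definition smooth_map (D : set 'rV[R]_2) : Prop :=
  (forall p, D p -> {for p, continuous F}) /\
  (forall i, smooth (D `&` F @^-1` dom i) (coord i \o F)).

Definition inner (i : chart N) (p : 'rV[R]_2) (v w : 'rV[R]_n) : R :=
  dot (h i (coord i (F p))) v w.

(* tangent uu = dF(d/du) and tangent vv = dF(d/dv) *)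
Definition tangent (k : 'I_2) : field := fun i => partial k (coord i \o F).

(* The induced metric is exp(2 lam) (du^2 + dv^2); in particular, F is an
   immersion and (u, v) are isothermal. *)
Definition conformal_immersion (D : set 'rV[R]_2) (lam : 'rV[R]_2 -> R) :
    Prop :=
  [/\ smooth_map D, smooth D lam &
      in_charts D (fun i p => forall k l,
        inner i p (tangent k i p) (tangent l i p) = expR (2 * lam p) *+ (k == l))].

Definition vector_field (U : set 'rV[R]_2) (V : field) : Prop :=
  (forall i, smooth (U `&` F @^-1` dom i) (V i)) /\
  (forall i j p, U p -> dom i (F p) -> dom j (F p) ->
     V j p = 'd (coord j \o param i) (coord i (F p)) (V i p)).

Definition normal_field (U : set 'rV[R]_2) (V : field) : Prop :=
  vector_field U V /\
  in_charts U (fun i p => forall k, inner i p (V i p) (tangent k i p) = 0).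

(* nabla_{T_k} V *)
Definition nabla (k : 'I_2) (V : field) : field := fun i p =>
  partial k (V i) p
  + connection_form (h i) (coord i (F p)) (tangent k i p) (V i p).

Definition normal_part (V : field) : field := fun i p =>
  let gram := \matrix_(k, l) inner i p (tangent k i p) (tangent l i p) in
  V i p - \sum_k \sum_l (invmx gram k l * inner i p (V i p) (tangent l i p))
            *: tangent k i p.

Definition nabla_perp (k : 'I_2) (V : field) : field :=
  normal_part (nabla k V).

(* The term of R^perp in [T_1, T_2] vanishes. *)
Definition flat_normal_connection (D : set 'rV[R]_2) : Prop :=
  forall V, normal_field D V -> in_charts D (fun i p =>
    nabla_perp uu (nabla_perp vv V) i p
    - nabla_perp vv (nabla_perp uu V) i p = 0).

Definition normal_frame (D : set 'rV[R]_2) (lam : 'rV[R]_2 -> R)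
    (N1 N2 : field) : Prop :=
  [/\ normal_field D N1, normal_field D N2 &
      in_charts D (fun i p =>
        [/\ inner i p (N1 i p) (N1 i p) = expR (2 * lam p),
            inner i p (N2 i p) (N2 i p) = expR (2 * lam p) &
            inner i p (N1 i p) (N2 i p) = 0])].

Definition second_fundamental_form (D : set 'rV[R]_2) (N1 N2 : field)
    (al1 al2 al3 be1 be2 be3 : 'rV[R]_2 -> R) : Prop :=
  in_charts D (fun i p =>
    [/\ normal_part (nabla uu (tangent uu)) i p = al1 p *: N1 i p + be1 p *: N2 i p,
        normal_part (nabla uu (tangent vv)) i p = al2 p *: N1 i p + be2 p *: N2 i p &
        normal_part (nabla vv (tangent vv)) i p = al3 p *: N1 i p + be3 p *: N2 i p]).

Definition normal_connection_form (D : set 'rV[R]_2) (lam : 'rV[R]_2 -> R)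
    (N1 N2 : field) (mu1 mu2 : 'rV[R]_2 -> R) : Prop :=
  in_charts D (fun i p =>
    [/\ nabla_perp uu N1 i p = partial uu lam p *: N1 i p + mu1 p *: N2 i p,
        nabla_perp uu N2 i p = - mu1 p *: N1 i p + partial uu lam p *: N2 i p,
        nabla_perp vv N1 i p = partial vv lam p *: N1 i p + mu2 p *: N2 i p &
        nabla_perp vv N2 i p = - mu2 p *: N1 i p + partial vv lam p *: N2 i p]).

Definition parallel_normal_field (U : set 'rV[R]_2) (xi : field) : Prop :=
  normal_field U xi /\
  in_charts U (fun i p => xi i p != 0 /\ forall k, nabla k xi i p = 0).

(* The normalization of xi is exp(-lam) (cos theta N1 + sin theta N2). *)
Definition normalized_form (U : set 'rV[R]_2) (lam : 'rV[R]_2 -> R)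
    (N1 N2 : field) (theta : 'rV[R]_2 -> R) (xi : field) : Prop :=
  in_charts U (fun i p =>
    (Num.sqrt (inner i p (xi i p) (xi i p)))^-1 *: xi i p =
    expR (- lam p) *: (cos (theta p) *: N1 i p + sin (theta p) *: N2 i p)).

End surfaces.

(* The curvature of exp(2 lam) (du^2 + dv^2). *)
Definition gauss_curvature (R : realType) (lam : 'rV[R]_2 -> R)
    (p : 'rV[R]_2) : R :=
  sectional_curvature (fun q => (expR (2 * lam q))%:M) p
    (delta_mx 0 uu) (delta_mx 0 vv).

Definition linearly_dependent (R : realType) (U : set 'rV[R]_2)
    (al1 al2 al3 be1 be2 be3 theta : 'rV[R]_2 -> R) : Prop :=
  smooth U theta /\
  forall p, U p ->
    [/\ cos (theta p) * al1 p + sin (theta p) * be1 p = 0,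
        cos (theta p) * al2 p + sin (theta p) * be2 p = 0 &
        cos (theta p) * al3 p + sin (theta p) * be3 p = 0].

Definition potential (R : realType) (U : set 'rV[R]_2)
    (mu1 mu2 gamma : 'rV[R]_2 -> R) : Prop :=
  smooth U gamma /\
  forall p, U p -> partial uu gamma p = mu1 p /\ partial vv gamma p = mu2 p.

Definition constant_on (R : realType) (U : set 'rV[R]_2)
    (f : 'rV[R]_2 -> R) : Prop :=
  exists c, forall p, U p -> f p = c.

(* Main.v *)
Require Import Defs.
From HB Require Import structures.
From mathcomp Require Import all_boot all_order all_algebra.
From mathcomp Require Import all_classical all_reals all_analysis.
From mathcomp Require Import ring lra.
Import Order.TTheory GRing.Theory Num.Theory.
Import numFieldNormedType.Exports.
Local Open Scope classical_set_scope.
Local Open Scope ring_scope.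
Set Implicit Arguments.
Unset Strict Implicit.
Unset Printing Implicit Defensive.

(** Let xi be a normal field. In the frame N1, N2 the ambient derivative of xi
    splits into a tangential part, which is minus the pairing of xi with the
    second fundamental form, and a normal part, which is governed by the normal
    connection form mu.

    If xi is parallel, both parts vanish. The normal part says that the components
    of xi, multiplied by e^lam, turn with speed - mu; as gam is a potential of mu,
    they are r (cos (c - gam), sin (c - gam)) for constants r > 0 and c
    ([parallel_normal_unit]). So theta = c - gam is the angle of xi, gam + theta is
    constant, and the tangential part says that cos theta alpha + sin theta beta = 0.
    Conversely these two conditions on theta make
    e^(-lam) (cos theta N1 + sin theta N2) parallel ([unit_normal_parallel]). This
    settles the case K = L0, and the case K <> L0 up to the claim that linear
    dependence alone forces gam + theta to be constant.

    For this claim, let tau = - sin theta alpha + cos theta beta be the coefficients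
    of the second fundamental form in the only remaining normal direction, and let
    w = d (gam + theta). The ambient curvature being constant, the Codazzi equation
    reads w_2 tau_1l = w_1 tau_2l ([codazzi_degenerate]). Where w is not zero this
    gives det tau = 0, and then K = L0 by the Gauss equation
    ([gauss_curvature_flat]), against the assumption ([degenerate_angle]).

    The potential gam exists because flatness of the normal connection is the
    closedness of mu ([normal_connection_closed]); it is the integral of mu along
    segments from p ([primitive_differentiable], [partial_primitive]).

    The two structure equations need the curvature of the ambient connection along
    the surface ([cov_commutator]) and the pair symmetry of the curvature tensor
    ([curvature_lower_pair]), which turns constancy of the sectional curvature into
    the vanishing of the mixed curvature components that occur in the Codazzi
    equation ([curvature_mixed']). All computations are done in one chart of the
    ambient manifold, for the data collected in [framed_surface]. *)


(** * Differentiability and entries of matrices *)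

Section germs.
Variables (R : realType) (V W : normedModType R).
Implicit Types f g : V -> W.

(** The differential is chosen among the continuous linear maps that approximate f;
    it suffices to exhibit one. *)
Lemma differentiable_approx f x (df : {linear V -> W}) : continuous df ->
  (forall e : R, 0 < e ->
     \forall h \near (0 : V), `|f (h + x) - f x - df h| <= e * `|h|) ->
  differentiable f x.
Proof.
move=> dfc fdf; apply/diff_locallyP.
have E : f \o shift x = cst (f x) + df +o_ (0 : V) id.
  apply/eqaddoP => e e0 /=; near do rewrite /= opprD addrA.
  exact: fdf.
by rewrite (diff_unique dfc E).
Unshelve. all: by end_near. Qed.

Lemma near_eq_differentiable f g x :
  {near x, f =1 g} -> differentiable f x -> differentiable g x.
Proof.
move=> fg dfx; apply: (@differentiable_approx _ _ ('d f x)).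
  exact: diff_continuous.
move=> e e0; have /eqaddoP/(_ e e0) := diff_locally dfx.
have fg0 : \forall h \near (0 : V), f (h + x) = g (h + x).
  have E := @near_shift _ _ (0 : V) x (fun z => f z = g z).
  by move: (fg : \near x, f x = g x); rewrite E subr0.
move=> H; near=> h.
rewrite -(near fg0 h)// -(nbhs_singleton fg).
rewrite -addrA -opprD; exact: (near H h).
Unshelve. all: by end_near. Qed.

End germs.

Section matrix_valued.
Variables (R : realType) (V : normedModType R) (m n : nat).
Implicit Types f : V -> 'M[R]_(m, n).

Lemma continuous_mxP f x :
  {for x, continuous f} <-> forall i j, {for x, continuous (fun z => f z i j : R)}.
Proof.
split=> [fx i j|fx].
  by apply: (@continuous_comp _ _ _ f (fun N : 'M[R]_(m, n) => N i j)) => //;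
    exact: coord_continuous.
apply/cvgrPdist_le => /= e e0; near=> z.
rewrite /Num.Def.normr/= mx_normrE (bigmax_le _ (ltW e0))//= => -[i j] _.
rewrite !mxE/=; move: i j; near: z.
apply: filter_forall => /= i; apply: filter_forall => /= j.
exact: ((cvgrPdist_le _ _).1 (fx i j)).
Unshelve. all: by end_near. Qed.

Lemma differentiable_mxP f x :
  differentiable f x <-> forall i j, differentiable (fun z => f z i j : R) x.
Proof.
split=> [fx i j|fx].
  by apply: (@differentiable_comp _ _ _ _ f (fun N : 'M[R]_(m, n) => N i j)) => //;
    exact: differentiable_coord.
have -> : f = \sum_i \sum_j (fun z => f z i j *: delta_mx i j).
  apply/funext => z; rewrite {1}[f z]matrix_sum_delta fct_sumE.
  by apply: eq_bigr => i _; rewrite fct_sumE.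
apply: differentiable_sum => i; apply: differentiable_sum => j.
exact: differentiableZl.
Qed.

End matrix_valued.

(** * Partial derivatives *)

Section partial_rules.
Variables (R : realType) (m : nat).
Implicit Types (x : 'rV[R]_m) (k : 'I_m).

Lemma partial_near (W : normedModType R) k (f g : 'rV[R]_m -> W) x :
  {near x, f =1 g} -> partial k f x = partial k g x.
Proof. exact: near_eq_derive. Qed.

Lemma partial_mx n1 n2 k (f : 'rV[R]_m -> 'M[R]_(n1, n2)) x i j :
  differentiable f x ->
  partial k f x i j = partial k (fun z => f z i j : R) x.
Proof. by move=> df; rewrite /partial derive_mx ?mxE//; exact: diff_derivable. Qed.

Lemma diff_partial (W : normedModType R) (f : 'rV[R]_m -> W) x v :
  differentiable f x -> 'd f x v = \sum_j v 0 j *: partial j f x.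
Proof.
move=> df; rewrite {1}[v]row_sum_delta linear_sum; apply: eq_bigr => j _.
by rewrite linearZ /partial deriveE.
Qed.

Lemma derive_partial (W : normedModType R) (f : 'rV[R]_m -> W) x v :
  differentiable f x -> 'D_v f x = \sum_j v 0 j *: partial j f x.
Proof. by move=> df; rewrite deriveE// diff_partial. Qed.

Lemma partial_cst (W : normedModType R) k (c : W) x : partial k (fun=> c) x = 0.
Proof. exact: derive_cst. Qed.

Lemma partialD (W : normedModType R) k (f g : 'rV[R]_m -> W) x :
  differentiable f x -> differentiable g x ->
  partial k (fun z => f z + g z) x = partial k f x + partial k g x.
Proof. by move=> df dg; apply: deriveD; exact: diff_derivable. Qed.

Lemma partialN (W : normedModType R) k (f : 'rV[R]_m -> W) x :
  differentiable f x -> partial k (fun z => - f z) x = - partial k f x.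
Proof. by move=> df; apply: deriveN; exact: diff_derivable. Qed.

Lemma partialM k (f g : 'rV[R]_m -> R) x :
  differentiable f x -> differentiable g x ->
  partial k (fun z => f z * g z) x = partial k f x * g x + f x * partial k g x.
Proof.
move=> df dg; rewrite /partial (@deriveM _ _ f g); try exact: diff_derivable.
by rewrite /GRing.scale /= addrC mulrC.
Qed.

Lemma partialMl k (c : R) (f : 'rV[R]_m -> R) x :
  differentiable f x -> partial k (fun z => c * f z) x = c * partial k f x.
Proof. by move=> df; rewrite partialM// partial_cst mul0r add0r. Qed.

Lemma differentiable_bigsum (W : normedModType R) (I : Type) (s : seq I)
    (P : pred I) (f : I -> 'rV[R]_m -> W) x :
  (forall i, P i -> differentiable (f i) x) ->
  differentiable (fun z => \sum_(i <- s | P i) f i z) x.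
Proof.
move=> df; elim: s => [|i s IH].
  by under eq_fun do rewrite big_nil; exact: differentiable_cst.
under eq_fun do rewrite big_cons; case Pi: (P i) => //.
by apply: (@differentiableD _ _ _ (f i)) => //; exact: df.
Qed.

Lemma partial_sum (W : normedModType R) k (I : Type) (s : seq I)
    (P : pred I) (f : I -> 'rV[R]_m -> W) x :
  (forall i, P i -> differentiable (f i) x) ->
  partial k (fun z => \sum_(i <- s | P i) f i z) x =
  \sum_(i <- s | P i) partial k (f i) x.
Proof.
move=> df; elim: s => [|i s IH].
  by under eq_fun do rewrite big_nil; rewrite big_nil partial_cst.
rewrite big_cons; under eq_fun do rewrite big_cons; case Pi: (P i) => //.
by rewrite -IH partialD//; [exact: df|exact: differentiable_bigsum].
Qed.

End partial_rules.

Section partial_composition.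
Variables (R : realType) (m : nat).
Implicit Types (x : 'rV[R]_m) (k : 'I_m).

Lemma partial_comp n (W : normedModType R) k (y : 'rV[R]_m -> 'rV[R]_n)
    (g : 'rV[R]_n -> W) x :
  differentiable y x -> differentiable g (y x) ->
  partial k (fun z => g (y z)) x = \sum_j (partial k y x) 0 j *: partial j g (y x).
Proof.
move=> dy dg; rewrite /partial deriveE; last exact: differentiable_comp.
have -> v : 'd (fun z => g (y z)) x v = ('d g (y x) \o 'd y x) v.
  by rewrite -(@diff_comp _ _ _ _ y g).
by rewrite /= diff_partial// -deriveE.
Qed.

Lemma differentiable_comp1 (phi : R -> R) (f : 'rV[R]_m -> R) x :
  derivable phi (f x) 1 -> differentiable f x ->
  differentiable (fun z => phi (f z)) x.
Proof.
move=> dphi df; apply: (@differentiable_comp _ _ _ _ f phi) => //.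
exact/derivable1_diffP.
Qed.

Lemma partial_comp1 k (phi : R -> R) (f : 'rV[R]_m -> R) x (d : R) :
  is_derive (f x) 1 phi d -> differentiable f x ->
  partial k (fun z => phi (f z)) x = d * partial k f x.
Proof.
move=> [dphi <-] df; have dphi' : differentiable phi (f x) by exact/derivable1_diffP.
rewrite /partial deriveE; last exact: differentiable_comp.
have -> v : 'd (fun z => phi (f z)) x v = ('d phi (f x) \o 'd f x) v.
  by rewrite -(@diff_comp _ _ _ _ f phi).
rewrite /=; have {1}-> : 'd f x (delta_mx 0 k) = 'd f x (delta_mx 0 k) *: (1 : R).
  by rewrite /GRing.scale /= mulr1.
by rewrite /= linearZ -!deriveE// /GRing.scale /= mulrC.
Qed.

Lemma differentiableMf (f g : 'rV[R]_m -> R) x :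
  differentiable f x -> differentiable g x ->
  differentiable (fun z => f z * g z) x.
Proof. exact: differentiableM. Qed.

Lemma differentiableDf (W : normedModType R) (f g : 'rV[R]_m -> W) x :
  differentiable f x -> differentiable g x ->
  differentiable (fun z => f z + g z) x.
Proof. exact: differentiableD. Qed.

Lemma differentiableNf (W : normedModType R) (f : 'rV[R]_m -> W) x :
  differentiable f x -> differentiable (fun z => - f z) x.
Proof. exact: differentiableN. Qed.

Lemma differentiable_scale n1 n2 (a : 'rV[R]_m -> R) (f : 'rV[R]_m -> 'M[R]_(n1, n2)) x :
  differentiable a x -> differentiable f x -> differentiable (fun z => a z *: f z) x.
Proof.
move=> da /differentiable_mxP df; apply/differentiable_mxP => i j.
under eq_fun do rewrite mxE; exact: differentiableMf.
Qed.

Lemma partialZ n1 n2 k (a : 'rV[R]_m -> R) (f : 'rV[R]_m -> 'M[R]_(n1, n2)) x :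
  differentiable a x -> differentiable f x ->
  partial k (fun z => a z *: f z) x = partial k a x *: f x + a x *: partial k f x.
Proof.
move=> da df; have df' := (differentiable_mxP f x).1 df.
apply/matrixP => i j; rewrite partial_mx; last exact: differentiable_scale.
under [X in partial k X]eq_fun do rewrite mxE.
by rewrite partialM// !mxE partial_mx.
Qed.

End partial_composition.

(** * Functions of class C^r *)

Section class_C_theory.
Variables (R : realType) (m : nat) (U : set 'rV[R]_m).
Hypothesis openU : open U.

Lemma open_near_eq (T : Type) (f g : 'rV[R]_m -> T) x :
  (forall z, U z -> f z = g z) -> U x -> {near x, f =1 g}.
Proof. by move=> fg Ux; apply: filterS (open_nbhs_nbhs (conj openU Ux)). Qed.

(** Since U is open, the condition depends on the values on U only. This is what
    allows partial derivatives to be replaced by formulas that hold on U. *)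
Lemma class_C_ext (W : normedModType R) r (f g : 'rV[R]_m -> W) :
  (forall x, U x -> f x = g x) -> class_C r U f -> class_C r U g.
Proof.
elim: r f g => [|r IH] f g fg /=.
  move=> cf x Ux; have fgx := open_near_eq fg Ux.
  change (g @ x --> g x); rewrite -(fg x Ux); apply: cvg_trans (cf x Ux).
  exact: (near_eq_cvg fgx).
move=> [df pf]; split=> [x Ux|k].
  exact: near_eq_differentiable (open_near_eq fg Ux) (df x Ux).
by apply: IH (pf k) => x Ux; apply: partial_near; exact: open_near_eq.
Qed.

Lemma class_C_pred (W : normedModType R) r (f : 'rV[R]_m -> W) :
  class_C r.+1 U f -> class_C r U f.
Proof.
elim: r f => [|r IH] f /= [df pf].
  by move=> x Ux; apply: differentiable_continuous; exact: df.
by split=> // k; apply: IH; exact: pf.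
Qed.

Lemma class_C_diff (W : normedModType R) r (f : 'rV[R]_m -> W) x :
  class_C r.+1 U f -> U x -> differentiable f x.
Proof. by move=> [+ _]; apply. Qed.

Lemma class_C_cst (W : normedModType R) r (c : W) : class_C r U (fun=> c).
Proof.
elim: r c => [|r IH] c /=; first by move=> x _; exact/differentiable_continuous/differentiable_cst.
split=> [x _|k]; first exact: differentiable_cst.
by apply: class_C_ext (IH 0) => x _; rewrite partial_cst.
Qed.

Lemma class_CD (W : normedModType R) r (f g : 'rV[R]_m -> W) :
  class_C r U f -> class_C r U g -> class_C r U (fun x => f x + g x).
Proof.
elim: r f g => [|r IH] f g /=.
  by move=> cf cg x Ux; exact: (continuousD (cf x Ux) (cg x Ux)).
move=> [df pf] [dg pg]; split=> [x Ux|k].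
  by apply: differentiableDf; [exact: df|exact: dg].
apply: class_C_ext (IH _ _ (pf k) (pg k)) => x Ux.
by rewrite partialD//; [exact: df|exact: dg].
Qed.

Lemma class_CN (W : normedModType R) r (f : 'rV[R]_m -> W) :
  class_C r U f -> class_C r U (fun x => - f x).
Proof.
elim: r f => [|r IH] f /=.
  by move=> cf x Ux; exact: (continuousN (cf x Ux)).
move=> [df pf]; split=> [x Ux|k]; first by apply: differentiableNf; exact: df.
by apply: class_C_ext (IH _ (pf k)) => x Ux; rewrite partialN//; exact: df.
Qed.

Lemma class_CM r (f g : 'rV[R]_m -> R) :
  class_C r U f -> class_C r U g -> class_C r U (fun x => f x * g x).
Proof.
elim: r f g => [|r IH] f g.
  by move=> cf cg x Ux; exact: (continuousM (cf x Ux) (cg x Ux)).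
move=> cf cg; have := cf; have := cg; move=> /= [dg pg] [df pf]; split=> [x Ux|k].
  by apply: differentiableMf; [exact: df|exact: dg].
have := class_CD (IH _ _ (pf k) (class_C_pred cg)) (IH _ _ (class_C_pred cf) (pg k)).
by apply: class_C_ext => x Ux; rewrite partialM//; [exact: df|exact: dg].
Qed.

Lemma class_C_sum (W : normedModType R) r (I : Type) (s : seq I) (P : pred I)
    (f : I -> 'rV[R]_m -> W) :
  (forall i, P i -> class_C r U (f i)) ->
  class_C r U (fun x => \sum_(i <- s | P i) f i x).
Proof.
move=> cf; elim: s => [|i s IH].
  by under eq_fun do rewrite big_nil; exact: class_C_cst.
under eq_fun do rewrite big_cons; case Pi: (P i) => //.
by apply: class_CD => //; exact: cf.
Qed.

Lemma class_C_prod r (I : Type) (s : seq I) (P : pred I) (f : I -> 'rV[R]_m -> R) :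
  (forall i, P i -> class_C r U (f i)) ->
  class_C r U (fun x => \prod_(i <- s | P i) f i x).
Proof.
move=> cf; elim: s => [|i s IH].
  by under eq_fun do rewrite big_nil; exact: class_C_cst.
under eq_fun do rewrite big_cons; case Pi: (P i) => //.
by apply: class_CM => //; exact: cf.
Qed.

Lemma class_CV r (f : 'rV[R]_m -> R) :
  (forall x, U x -> f x != 0) -> class_C r U f -> class_C r U (fun x => (f x)^-1).
Proof.
move=> f0; elim: r f f0 => [|r IH] f f0.
  by move=> cf x Ux; exact: (continuousV (f0 x Ux) (cf x Ux)).
move=> cf; have := cf; move=> /= [df pf]; split=> [x Ux|k].
  by apply: differentiableV; [exact: df|exact: f0].
have ci := IH f f0 (class_C_pred cf).
have := class_CN (class_CM (class_CM ci ci) (pf k)).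
apply: class_C_ext => x Ux; rewrite /partial (@deriveV _ _ f).
- by rewrite /GRing.scale /= -mulNr -exprVn expr2.
- exact: f0.
- by apply: diff_derivable; exact: df.
Qed.

(** The induction on r replaces the i-th function by the next one, so that it
    applies to functions given with all their derivatives, such as the
    exponential and the trigonometric functions. *)
Lemma class_C_comp1 r (phi : nat -> R -> R) (f : 'rV[R]_m -> R) :
  (forall i (t : R), is_derive t 1 (phi i) (phi i.+1 t)) ->
  class_C r U f -> forall i, class_C r U (fun x => phi i (f x)).
Proof.
move=> dphi; elim: r f => [|r IH] f cf i.
  move=> x Ux; apply: (@continuous_comp _ _ _ f (phi i)); first exact: cf.
  apply: differentiable_continuous; apply/derivable1_diffP.
  by have [] := dphi i (f x).
have [df pf] := cf; split=> [x Ux|k].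
  apply: differentiable_comp1; last exact: df.
  by have [] := dphi i (f x).
have := class_CM (IH _ (class_C_pred cf) i.+1) (pf k).
apply: class_C_ext => x Ux; rewrite (partial_comp1 _ (dphi i (f x)))//.
exact: df.
Qed.

Lemma class_C_expR r (f : 'rV[R]_m -> R) :
  class_C r U f -> class_C r U (fun x => expR (f x)).
Proof. by move=> cf; apply: (@class_C_comp1 r (fun=> expR) f _ cf 0%N). Qed.

(** The successive derivatives of the cosine run through a cycle of length four,
    which also contains the sine. *)
Let trig (i : nat) : R -> R :=
  nth cos [:: cos; (fun t => - sin t); (fun t => - cos t); sin] (i %% 4).

Let is_derive_trig i (t : R) : is_derive t 1 (trig i) (trig i.+1 t).
Proof.
rewrite /trig -[i.+1]addn1 -modnDml; have := ltn_pmod i (isT : (0 < 4)%N).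
case: (i %% 4)%N => [|[|[|[|//]]]] _ /=.
- exact: is_derive_cos.
- exact: (is_deriveN (is_derive_sin t)).
- by rewrite -[sin t]opprK; exact: (is_deriveN (is_derive_cos t)).
- exact: is_derive_sin.
Qed.

Lemma class_C_cos r (f : 'rV[R]_m -> R) :
  class_C r U f -> class_C r U (fun x => cos (f x)).
Proof. by move=> cf; apply: (@class_C_comp1 r trig f is_derive_trig cf 0%N). Qed.

Lemma class_C_sin r (f : 'rV[R]_m -> R) :
  class_C r U f -> class_C r U (fun x => sin (f x)).
Proof. by move=> cf; apply: (@class_C_comp1 r trig f is_derive_trig cf 3%N). Qed.

Lemma class_C_mxP r n1 n2 (f : 'rV[R]_m -> 'M[R]_(n1, n2)) :
  class_C r U f <-> forall i j, class_C r U (fun x => f x i j : R).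
Proof.
elim: r f => [|r IH] f.
  split=> [cf i j x Ux|cf x Ux].
    by have /continuous_mxP := cf x Ux; apply.
  by apply/continuous_mxP => i j; exact: cf.
split=> [[df pf] i j|cf].
  split=> [x Ux|k].
    by have /differentiable_mxP := df x Ux; apply.
  by apply: class_C_ext ((IH _).1 (pf k) i j) => x Ux; rewrite partial_mx//; exact: df.
have df x : U x -> differentiable f x.
  by move=> Ux; apply/differentiable_mxP => i j; have [+ _] := cf i j; apply.
split=> // k; apply/IH => i j; have [_ /(_ k)] := cf i j.
by apply: class_C_ext => x Ux; rewrite partial_mx//; exact: df.
Qed.

Lemma class_CZ r n1 n2 (a : 'rV[R]_m -> R) (f : 'rV[R]_m -> 'M[R]_(n1, n2)) :
  class_C r U a -> class_C r U f -> class_C r U (fun x => a x *: f x).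
Proof.
move=> ca /class_C_mxP cf; apply/class_C_mxP => i j.
by under eq_fun do rewrite mxE; exact: class_CM.
Qed.

(** By the chain rule the partial derivatives of the composite are sums of
    products of functions of the same kind, of lower order. *)
Lemma class_C_comp r n (O : set 'rV[R]_n) (y : 'rV[R]_m -> 'rV[R]_n)
    (g : 'rV[R]_n -> R) :
  (forall x, U x -> O (y x)) -> class_C r U y -> class_C r O g ->
  class_C r U (fun x => g (y x)).
Proof.
move=> yO; elim: r g => [|r IH] g cy cg.
  move=> x Ux; apply: (@continuous_comp _ _ _ y g); first exact: cy.
  by apply: cg; exact: yO.
have [dy py] := cy; have [dg pg] := cg; split=> [x Ux|k].
  by apply: (@differentiable_comp _ _ _ _ y g); [exact: dy|apply: dg; exact: yO].
have cpy := (class_C_mxP r (partial k y)).1 (py k) 0.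
have := @class_C_sum _ r _ (index_enum 'I_n) xpredT _
  (fun j _ => class_CM (cpy j) (IH _ (class_C_pred cy) (pg j))).
apply: class_C_ext => x Ux; rewrite (partial_comp _ (dy x Ux))//.
by apply: dg; exact: yO.
Qed.

Lemma class_C_det r n (A : 'rV[R]_m -> 'M[R]_n) :
  (forall i j, class_C r U (fun x => A x i j : R)) ->
  class_C r U (fun x => \det (A x)).
Proof.
move=> cA; apply: class_C_sum => s _; apply: class_CM; first exact: class_C_cst.
exact: class_C_prod.
Qed.

(** Cramer's formula expresses the entries as quotients of determinants. *)
Lemma class_C_invmx r n (A : 'rV[R]_m -> 'M[R]_n) :
  (forall x, U x -> A x \in unitmx) ->
  class_C r U A -> class_C r U (fun x => invmx (A x)).
Proof.
move=> uA /class_C_mxP cA; apply/class_C_mxP => i j.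
have cdet : class_C r U (fun x => \det (A x)) by exact: class_C_det.
have d0 x : U x -> \det (A x) != 0 by move=> Ux; rewrite -unitfE -unitmxE uA.
have cadj : class_C r U (fun x => \adj (A x) i j).
  have : class_C r U (fun x => cofactor (A x) j i).
    apply: class_CM; first exact: class_C_cst.
    by apply: class_C_det => a b; under eq_fun do rewrite !mxE; exact: cA.
  by apply: class_C_ext => x _; rewrite mxE.
have := class_CM (class_CV d0 cdet) cadj.
by apply: class_C_ext => x Ux; rewrite /invmx (uA x Ux) [RHS]mxE.
Qed.

End class_C_theory.

Lemma class_C_subset (R : realType) m (W : normedModType R) (U U' : set 'rV[R]_m)
    r (f : 'rV[R]_m -> W) :
  U' `<=` U -> class_C r U f -> class_C r U' f.
Proof.
move=> UU; elim: r f => [|r IH] f /=; first by move=> cf x /UU; exact: cf.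
by move=> [df pf]; split=> [x /UU|k]; [exact: df|exact: IH].
Qed.

(** * Mean value theorem and second derivatives *)

Section mean_value.
Variables (R : realType) (V : normedModType R).
Implicit Types (f : V -> R) (x v : V).

Lemma is_derive_line f x v (t : R) : derivable f (x + t *: v) v ->
  is_derive t 1 (fun s : R => f (x + s *: v)) ('D_v f (x + t *: v)).
Proof.
move=> df; set g := fun s : R => _.
have E : (fun h : R => h^-1 *: ((g \o shift t) (h *: 1) - g t)) =
         (fun h : R => h^-1 *: ((f \o shift (x + t *: v)) (h *: v) - f (x + t *: v))).
  apply/funext => h; rewrite /g /=; congr (_ *: (f _ - _)).
  by rewrite [h *: 1]mulr1 scalerDl addrCA.
by split; [rewrite /derivable E|rewrite /derive E].
Qed.

(** Only differentiability along the segment is assumed; this is used to prove the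
    differentiability of a function whose directional derivatives are known. *)
Lemma MVT_line f x v :
  (forall t : R, 0 <= t <= 1 -> derivable f (x + t *: v) v) ->
  exists2 c : R, 0 <= c <= 1 & f (x + v) - f x = 'D_v f (x + c *: v).
Proof.
move=> df; pose g (s : R) := f (x + s *: v).
have dg (t : R) : 0 <= t <= 1 -> is_derive t 1 g ('D_v f (x + t *: v)).
  by move=> t01; apply: is_derive_line; exact: df.
have [||c c01] := @MVT_segment R g (fun t => 'D_v f (x + t *: v)) 0 1 ler01.
- move=> t; rewrite in_itv /= => /andP[t0 t1]; apply: dg.
  by rewrite !ltW.
- apply: derivable_within_continuous => t; rewrite in_itv /= => t01.
  by have [] := dg t t01.
by rewrite /g scale1r scale0r addr0 subr0 mulr1 => E; exists c.
Qed.

End mean_value.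

Section mixed_partials.
Variables (R : realType) (m : nat).
Implicit Types (x : 'rV[R]_m) (U : set 'rV[R]_m).

Lemma norm_entry n (v : 'rV[R]_n) j : `|v 0 j| <= `|v|.
Proof.
rewrite [leRHS]/Num.Def.normr/= mx_normrE.
exact: (le_bigmax _ (fun i : 'I_1 * 'I_n => `|v i.1 i.2|) (0, j)).
Qed.

Lemma norm_delta (k : 'I_m) : `|delta_mx 0 k : 'rV[R]_m| <= 1.
Proof.
rewrite /Num.Def.normr/= mx_normrE bigmax_le// => i _.
by rewrite !mxE; case: (_ && _); rewrite ?normr1 ?normr0.
Qed.

(** The mean value theorem is applied twice: in the direction a to the increment
    of f in the direction b, then in the direction b to the partial derivative. *)
Lemma second_difference U (f : 'rV[R]_m -> R) x (a b : 'I_m) (t : R) :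
  class_C 2 U f -> 0 < t ->
  (forall s s' : R, 0 <= s <= t -> 0 <= s' <= t ->
     U (x + s *: delta_mx 0 a + s' *: delta_mx 0 b)) ->
  exists s s' : R, [/\ 0 <= s <= t, 0 <= s' <= t &
    f (x + t *: delta_mx 0 a + t *: delta_mx 0 b) - f (x + t *: delta_mx 0 a)
     - (f (x + t *: delta_mx 0 b) - f x) =
    t ^+ 2 * partial b (partial a f) (x + s *: delta_mx 0 a + s' *: delta_mx 0 b)].
Proof.
move=> [df pf] t0 Uxt; pose A : 'rV[R]_m := delta_mx 0 a; pose B : 'rV[R]_m := delta_mx 0 b.
have tt : 0 <= t <= t by rewrite ltW/=.
have zt : 0 <= (0 : R) <= t by rewrite lexx ltW.
have ct (c : R) : 0 <= c <= 1 -> 0 <= c * t <= t.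
  by move=> /andP[c0 c1]; rewrite mulr_ge0 ?(ltW t0)//= ler_piMl// ltW.
have dfp s s' : 0 <= s <= t -> 0 <= s' <= t ->
    differentiable f (x + s *: A + s' *: B) by move=> hs hs'; apply: df; exact: Uxt.
have dfs s : 0 <= s <= t -> differentiable f (x + s *: A).
  by move=> hs; have := dfp s 0 hs zt; rewrite scale0r addr0.
pose g z := f (z + t *: B) - f z.
have dg s : 0 <= s <= t -> is_derive (x + s *: A) A g
   (partial a f (x + s *: A + t *: B) - partial a f (x + s *: A)).
  move=> hs; apply: (@is_deriveB _ _ _ (fun z => f (z + t *: B)) f); last first.
    exact/derivableP/diff_derivable/dfs.
  have E : (fun h : R => h^-1 *: (((fun z => f (z + t *: B)) \o shift (x + s *: A)) (h *: A) - f (x + s *: A + t *: B))) =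
    (fun h : R => h^-1 *: ((f \o shift (x + s *: A + t *: B)) (h *: A) - f (x + s *: A + t *: B))).
    by apply/funext => h /=; rewrite !addrA.
  split; last by rewrite /partial /derive E.
  by rewrite /derivable E; apply: diff_derivable; exact: dfp.
have dgt s : 0 <= s <= t -> is_derive (x + s *: A) (t *: A) g
   (t * (partial a f (x + s *: A + t *: B) - partial a f (x + s *: A))).
  move=> hs; have [h1 h2] := dg s hs.
  have dgs : differentiable g (x + s *: A).
    apply: (@differentiableB _ _ _ (fun z => f (z + t *: B)) f); last exact: dfs.
    by apply: (@differentiable_comp _ _ _ _ (fun z => z + t *: B) f) => //; exact: dfp.
  split; first exact: diff_derivable.
  by rewrite deriveE// linearZ /= -deriveE// h2.
have [c /ct c01|c /ct c01 E1] := @MVT_line R _ g x (t *: A).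
  by rewrite scalerA; have [] := dgt _ c01.
have cdf s' : 0 <= s' <= t -> differentiable (partial a f) (x + (c * t) *: A + s' *: B).
  by move=> hs'; have [+ _] := pf a; apply; exact: Uxt.
have [c' /ct c'01|c' /ct c'01 E2] := @MVT_line R _ (partial a f) (x + (c * t) *: A) (t *: B).
  by rewrite scalerA; apply: diff_derivable; exact: cdf.
exists (c * t), (c' * t); split=> //.
have -> : f (x + t *: delta_mx 0 a + t *: delta_mx 0 b) - f (x + t *: delta_mx 0 a) =
  g (x + t *: A) by [].
rewrite -[f (x + _) - f x]/(g x) E1 scalerA.
have [_ ->] := dgt _ c01; rewrite E2 scalerA.
rewrite [X in t * X]deriveE; last exact: cdf.
rewrite linearZ /= -deriveE; last exact: cdf.
by rewrite expr2 -mulrA.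
Qed.

(** The second difference of f is symmetric in the two directions, hence the two
    mixed derivatives agree at points arbitrarily close to x, and they are
    continuous. *)
Lemma partialC U (f : 'rV[R]_m -> R) x (a b : 'I_m) :
  open U -> class_C 2 U f -> U x ->
  partial a (partial b f) x = partial b (partial a f) x.
Proof.
move=> oU cf Ux; apply/eqP; rewrite -subr_eq0 -normr_le0.
apply/ler_addgt0Pr => e e0; rewrite add0r.
have [_ pf] := cf; have [_ /(_ a) cba] := pf b; have [_ /(_ b) cab] := pf a.
have : nbhs x (U `&` [set z | `|partial a (partial b f) x - partial a (partial b f) z| < e / 2]
  `&` [set z | `|partial b (partial a f) x - partial b (partial a f) z| < e / 2]).
  apply: filterI; [apply: filterI|].
  - exact: open_nbhs_nbhs.
  - by have /cvgrPdist_lt := cba x Ux; apply; rewrite divr_gt0.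
  - by have /cvgrPdist_lt := cab x Ux; apply; rewrite divr_gt0.
move=> /nbhs_ballP[d /= d0 sub].
pose t := d / 3; have t0 : 0 < t by rewrite divr_gt0.
have near_x k l (s s' : R) : 0 <= s <= t -> 0 <= s' <= t ->
    ball x d (x + s *: delta_mx 0 k + s' *: delta_mx 0 l).
  move=> /andP[s0 st] /andP[s'0 s't]; rewrite -ball_normE /= -addrA opprD addNKr.
  rewrite normrN (le_lt_trans (ler_normD _ _))// !normrZ !ger0_norm//.
  have := norm_delta k; have := norm_delta l.
  move=> h1 h2; have := ler_wpM2l s'0 h1; have := ler_wpM2l s0 h2.
  rewrite !mulr1 => h3 h4; rewrite (le_lt_trans (lerD h3 h4))//.
  rewrite (le_lt_trans (lerD st s't))// /t; lra.
have box k l (s s' : R) hs hs' := sub _ (near_x k l s s' hs hs').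
have [s [s' [hs hs' E]]] := second_difference (x := x) (a := a) (b := b) cf t0
  (fun s s' hs hs' => (box a b s s' hs hs').1.1).
have [r [r' [hr hr' E']]] := second_difference (x := x) (a := b) (b := a) cf t0
  (fun s s' hs hs' => (box b a s s' hs hs').1.1).
have [_ h1] := box a b s s' hs hs'; have [[_ h2] _] := box b a r r' hr hr'.
have : t ^+ 2 * partial b (partial a f) (x + s *: delta_mx 0 a + s' *: delta_mx 0 b) =
       t ^+ 2 * partial a (partial b f) (x + r *: delta_mx 0 b + r' *: delta_mx 0 a).
  have swap (y1 y2 y3 y4 : R) : y1 - y2 - (y3 - y4) = y1 - y3 - (y2 - y4) by ring.
  have C := addrAC x (t *: delta_mx 0 b) (t *: delta_mx 0 a : 'rV[R]_m).
  rewrite C in E'; apply: etrans (esym E) _; apply: etrans E'.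
  exact: swap.
move=> /(mulfI (lt0r_neq0 (exprn_gt0 2 t0))) EE.
move: h1 h2; rewrite /= EE.
move: (partial a (partial b f) (x + _ + _)) (partial a (partial b f) x) => M L1.
move: (partial b (partial a f) x) => L2 h2 h1.
clear -h1 h2.
apply: (le_trans (ler_distD M _ _)); rewrite (splitr e); apply: lerD; first exact: ltW.
by rewrite distrC; exact: ltW.
Qed.

Lemma partial_mxC U n1 n2 (f : 'rV[R]_m -> 'M[R]_(n1, n2)) x (a b : 'I_m) :
  open U -> class_C 2 U f -> U x ->
  partial a (partial b f) x = partial b (partial a f) x.
Proof.
move=> oU cf Ux; apply/matrixP => i j.
have df z : U z -> differentiable f z by move=> Uz; exact: class_C_diff cf Uz.
have [_ pf] := cf; have [da _] := pf a; have [db _] := pf b.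
apply: etrans (partial_mx a i j (db x Ux)) _.
apply: etrans (esym (partial_mx b i j (da x Ux))).
have cij := (class_C_mxP oU 2 f).1 cf i j.
transitivity (partial a (partial b (fun z => f z i j : R)) x).
  apply: partial_near; apply: (open_near_eq oU) Ux => z Uz.
  exact: partial_mx (df z Uz).
apply: etrans (partialC a b oU cij Ux) _.
apply: partial_near; apply: (open_near_eq oU) Ux => z Uz.
by apply: esym; exact: partial_mx (df z Uz).
Qed.

(** A level set of f is open by the mean value theorem on small balls, and so is
    its complement. *)
Lemma constant_of_partial0 U (f : 'rV[R]_m -> R) :
  open U -> connected U ->
  (forall x, U x -> differentiable f x) ->
  (forall x k, U x -> partial k f x = 0) ->
  forall x y, U x -> U y -> f x = f y.
Proof.
move=> oU cU df pf x y Ux Uy.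
have loc z : U z -> \forall w \near z, U w /\ f w = f z.
  move=> Uz; have /nbhs_ballP[d /= d0 sub] := open_nbhs_nbhs (conj oU Uz).
  apply/nbhs_ballP; exists d => //= w zw; split; first exact: sub.
  have seg (t : R) : 0 <= t <= 1 -> U (z + t *: (w - z)).
    move=> /andP[t0 t1]; apply: sub; rewrite -ball_normE /= opprD addNKr normrN normrZ.
    rewrite ger0_norm// (le_lt_trans (ler_piMl _ t1))//.
    by move: zw; rewrite -ball_normE /= distrC.
  have [t t01|c c01] := @MVT_line R _ f z (w - z).
    by apply/diff_derivable/df; exact: seg.
  rewrite derive_partial; last by apply: df; exact: seg.
  rewrite big1 => [|j _]; last by rewrite pf ?scaler0//; exact: seg.
  by rewrite [z + _]addrC subrK => /eqP; rewrite subr_eq0 => /eqP.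
pose B := [set z | U z /\ f z = f x].
have BU : B = U.
  apply: cU.
  - by exists x.
  - exists B.
      rewrite openE => z [Uz fz]; have := loc z Uz; apply: filterS => w [Uw fw].
      by split=> //; rewrite fw.
    by apply/seteqP; split=> [z []|z []].
  - exists (~` [set z | U z /\ f z <> f x]).
      apply: open_closedC; rewrite openE => z [Uz fz].
      by have := loc z Uz; apply: filterS => w [Uw fw]; split=> //; rewrite fw.
    apply/seteqP; split=> [z [Uz fz]|z [Uz fz]]; first by split=> // -[].
    by split=> //; apply: contrapT => fz'; apply: fz.
by move: Uy; rewrite -BU => -[_ ->].
Qed.

End mixed_partials.

(** * The Poincare lemma on a ball *)

Section linear_combination.
Variables (R : realType) (m : nat) (c : 'I_m -> R).

(** A differential has to be given as a bundled linear map. *)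
Definition lincomb (v : 'rV[R]_m) : R := \sum_j v 0 j * c j.

Let lincomb_is_linear : linear lincomb.
Proof.
move=> a u v; rewrite /lincomb scaler_sumr -big_split; apply: eq_bigr => j _.
by rewrite !mxE mulrDl -mulrA.
Qed.

HB.instance Definition _ :=
  GRing.isLinear.Build R 'rV[R]_m R _ lincomb lincomb_is_linear.

Lemma lincomb_continuous : continuous lincomb.
Proof.
move=> x; apply: differentiable_continuous.
apply: differentiable_bigsum => j _; apply: differentiableMf.
  exact: differentiable_coord.
exact: differentiable_cst.
Qed.

End linear_combination.

Section derive_functions.
Variables (R : realType) (V : normedModType R).
Implicit Types (f g : V -> R) (x v : V).

Lemma is_deriveMf f g x v (df dg : R) : is_derive x v f df -> is_derive x v g dg ->
  is_derive x v (fun z => f z * g z) (df * g x + f x * dg).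
Proof.
move=> hf hg; apply: is_derive_eq (is_deriveM hf hg) _.
by rewrite /GRing.scale /= addrC mulrC.
Qed.

Lemma derive_lineE f x v : 'D_v f x = 'D_1 (fun h : R => f (h *: v + x)) 0.
Proof.
rewrite /derive; set g1 := fun h => h^-1 *: _; set g2 := fun h => h^-1 *: _.
suff -> : g1 = g2 by [].
by apply/funext => h; rewrite /g1 /g2 /= addr0 scale0r add0r [_%:A]mulr1.
Qed.

Lemma is_derive_bigsum n (h : 'I_n -> V -> R) x v (dh : 'I_n -> R) :
  (forall i, is_derive x v (h i) (dh i)) ->
  is_derive x v (fun z => \sum_i h i z) (\sum_i dh i).
Proof.
move=> hh; have -> : (fun z => \sum_i h i z) = \sum_i h i.
  by apply/funext => z; rewrite fct_sumE.
exact: is_derive_sum.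
Qed.

Lemma continuous_bigsum (I : Type) (s : seq I) (P : pred I) (f : I -> V -> R) x :
  (forall i, P i -> {for x, continuous (f i)}) ->
  {for x, continuous (fun z => \sum_(i <- s | P i) f i z)}.
Proof.
move=> cf; elim: s => [|i s IH].
  have -> : (fun z => \sum_(i <- [::] | P i) f i z) = (fun=> 0).
    by apply/funext => z; rewrite big_nil.
  exact: cst_continuous.
case Pi: (P i); last first.
  have -> // : (fun z => \sum_(j <- i :: s | P j) f j z) =
    (fun z => \sum_(j <- s | P j) f j z).
  by apply/funext => z; rewrite big_cons Pi.
have -> : (fun z => \sum_(j <- i :: s | P j) f j z) =
    (fun z => f i z + \sum_(j <- s | P j) f j z).
  by apply/funext => z; rewrite big_cons Pi.
exact: (continuousD (cf i Pi) IH).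
Qed.

End derive_functions.

Section poincare.
Variables (R : realType) (m : nat) (mu : 'I_m -> 'rV[R]_m -> R).
Variables (p : 'rV[R]_m) (r : R).
Let B : set 'rV[R]_m := ball p r.
Hypothesis mu_C1 : forall k, class_C 1 B (mu k).
Hypothesis mu_closed : forall j k (x : 'rV[R]_m), B x ->
  partial j (mu k) x = partial k (mu j) x.

Local Notation leb := (@lebesgue_measure R).

Definition radial_integrand (y : 'rV[R]_m) (t : R) : R :=
  lincomb (fun k => mu k (p + t *: (y - p))) (y - p).

(** The integral, along the segment from p to y, of the differential form with
    coefficients mu. *)
Definition primitive (y : 'rV[R]_m) : R :=
  \int[leb]_(t in `[0, 1]) radial_integrand y t.

Let dmu (k : 'I_m) (z v : 'rV[R]_m) : R := \sum_j v 0 j * partial j (mu k) z.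

Let openB : open B. Proof. exact: ball_open. Qed.

Let inB (t : R) (y : 'rV[R]_m) d : 0 <= t <= 1 -> `|y - p| <= d ->
  `|p - (p + t *: (y - p))| <= d.
Proof.
move=> /andP[t0 t1] yd; rewrite opprD addNKr normrN normrZ ger0_norm//.
by rewrite (le_trans (ler_piMl _ t1)).
Qed.

Let inB' (t : R) (y : 'rV[R]_m) : 0 <= t <= 1 -> B y -> B (p + t *: (y - p)).
Proof.
move=> t01; rewrite /B -ball_normE /= distrC => yr.
exact: le_lt_trans (inB t01 (lexx _)) yr.
Qed.

Let diff_mu (k : 'I_m) (z : 'rV[R]_m) : B z -> differentiable (mu k) z.
Proof. by move=> Bz; exact: class_C_diff (mu_C1 k) Bz. Qed.

Let derive_mu (k : 'I_m) (z v : 'rV[R]_m) : B z -> 'D_v (mu k) z = dmu k z v.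
Proof. by move=> Bz; rewrite derive_partial//; exact: diff_mu. Qed.

Let cont_mu (k : 'I_m) : class_C 0 B (mu k).
Proof. exact: class_C_pred (mu_C1 k). Qed.

Let cont_dmu (k : 'I_m) (v : 'rV[R]_m) : class_C 0 B (fun z => dmu k z v).
Proof.
apply: class_C_sum => // j _; apply: class_CM => //; first exact: class_C_cst.
by have [_] := mu_C1 k; apply.
Qed.

Let line_continuous (f : 'rV[R]_m -> R) (u : 'rV[R]_m) (t : R) :
  class_C 0 B f -> B (p + t *: u) -> {for t, continuous (fun t : R => f (p + t *: u))}.
Proof.
move=> cf Bz; apply: (@continuous_comp _ _ _ (fun t : R => p + t *: u) f).
  by apply: cvgD; [exact: cvg_cst|exact: scalel_continuous].
exact: cf.
Qed.

(** The directional derivative of [radial_integrand] with respect to y. *)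
Let dintegrand (v y : 'rV[R]_m) (t : R) : R :=
  \sum_k (v 0 k * mu k (p + t *: (y - p))
    + (y - p) 0 k * (t * dmu k (p + t *: (y - p)) v)).

Let is_derive_integrand (v y : 'rV[R]_m) (t s : R) :
  B (p + t *: (s *: v + y - p)) ->
  is_derive s 1 (fun s : R => radial_integrand (s *: v + y) t)
    (dintegrand v (s *: v + y) t).
Proof.
move=> Bz; apply: is_derive_bigsum => k; apply: is_deriveMf.
  have -> : (fun s : R => (s *: v + y - p) 0 k) = (fun s => s * v 0 k + (y - p) 0 k).
    by apply/funext => s'; rewrite !mxE addrA.
  have h := is_deriveD (is_deriveMf (is_derive_id s 1) (is_derive_cst (v 0 k) s 1))
              (is_derive_cst ((y - p) 0 k) s 1).
  by apply: is_derive_eq h _; rewrite mulr0 !addr0 mul1r.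
have E s' : p + t *: (s' *: v + y - p) = p + t *: (y - p) + s' *: (t *: v).
  by rewrite -addrA scalerDr !scalerA (mulrC s') addrA addrAC.
have -> : (fun s : R => mu k (p + t *: (s *: v + y - p))) =
    (fun s : R => mu k (p + t *: (y - p) + s *: (t *: v))).
  by apply/funext => s'; rewrite E.
rewrite E in Bz; have dz := diff_mu k Bz.
have -> : t * dmu k (p + t *: (s *: v + y - p)) v =
    'D_(t *: v) (mu k) (p + t *: (y - p) + s *: (t *: v)).
  rewrite derive_mu// -E /dmu mulr_sumr; apply: eq_bigr => j _.
  by rewrite mxE mulrA.
by apply: is_derive_line; exact: diff_derivable.
Qed.

Let is_derive_radial (k : 'I_m) (u : 'rV[R]_m) (t : R) : B (p + t *: u) ->
  is_derive t 1 (fun t : R => mu k (p + t *: u)) (dmu k (p + t *: u) u).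
Proof.
move=> Bz; rewrite -derive_mu//; apply: is_derive_line.
by apply: diff_derivable; exact: diff_mu.
Qed.

Let dintegrand_continuous (v y : 'rV[R]_m) (t : R) : B (p + t *: (y - p)) ->
  {for t, continuous (dintegrand v y)}.
Proof.
move=> Bz.
apply: continuous_bigsum => k _.
have c1 := @line_continuous (mu k) (y - p) t (@cont_mu k) Bz.
have c2 := @line_continuous (fun z => dmu k z v) (y - p) t (@cont_dmu k v) Bz.
have cc (c : R) : {for t, continuous (fun=> c)} by exact: cst_continuous.
have ci : {for t, continuous (fun t : R => t)} by exact: cvg_id.
exact: (continuousD (continuousM (cc _) c1) (continuousM (cc _) (continuousM ci c2))).
Qed.

(** As the form is closed, the integrand is the derivative of
    t |-> t mu(p + t (x - p)) (v). *)
Let dintegrand_exact (v x : 'rV[R]_m) : B x ->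
  \int[leb]_(t in `[0, 1]) dintegrand v x t = lincomb (mu^~ x) v.
Proof.
move=> Bx; pose u := x - p.
pose F (t : R) := t * lincomb (fun k => mu k (p + t *: u)) v.
have dF (t : R) : 0 <= t <= 1 -> is_derive t 1 F (dintegrand v x t).
  move=> t01; have Bz := inB' t01 Bx; rewrite -/u in Bz.
  have h : is_derive t 1 (fun t : R => lincomb (fun k => mu k (p + t *: u)) v)
     (\sum_k v 0 k * dmu k (p + t *: u) u).
    apply: is_derive_bigsum => k.
    apply: is_derive_eq (is_deriveMf (is_derive_cst (v 0 k) t 1) (is_derive_radial k Bz)) _.
    by rewrite mul0r add0r.
  apply: is_derive_eq (is_deriveMf (is_derive_id t 1) h) _.
  rewrite mul1r /dintegrand big_split /=; congr (_ + _).
  transitivity (t * \sum_k u 0 k * dmu k (p + t *: u) v); last first.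
    by rewrite mulr_sumr; apply: eq_bigr => k _; rewrite mulrCA.
  congr (_ * _); rewrite /dmu.
  under eq_bigr do rewrite mulr_sumr; rewrite exchange_big /=.
  apply: eq_bigr => k _; rewrite mulr_sumr; apply: eq_bigr => j _.
  by rewrite mulrCA (mu_closed _ _ Bz).
have cF (t : R) : 0 <= t <= 1 -> {for t, continuous F}.
  move=> t01; apply: differentiable_continuous; apply/derivable1_diffP.
  by have [] := dF t t01.
rewrite /Rintegral (@continuous_FTC2 R (dintegrand v x) F 0 1 ltr01) /=.
- by rewrite /F mul1r mul0r subr0 scale1r addrC subrK.
- apply: continuous_in_subspaceT => t; rewrite inE /= in_itv /= => t01.
  exact/dintegrand_continuous/inB'.
- split.
  + by move=> t; rewrite in_itv /= => /andP[t0 t1]; have [] := dF t; rewrite ?ltW.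
  + by apply: cvg_at_right_filter; apply: cF; rewrite lexx ler01.
  + by apply: cvg_at_left_filter; apply: cF; rewrite lexx ler01.
- move=> t; rewrite in_itv /= => /andP[t0 t1]; rewrite derive1E.
  have t01 : 0 <= t <= 1 by rewrite !ltW.
  by have [_] := dF t t01.
Qed.

(** Differentiation under the integral sign, in an arbitrary direction. The points
    p + t (y - p), for y on a small segment through x, stay in a closed ball
    inside B, where continuity gives a bound for the derivative. *)
Let is_derive_primitive (v x : 'rV[R]_m) : B x ->
  is_derive x v primitive (lincomb (mu^~ x) v).
Proof.
rewrite /B -ball_normE /= distrC => xr.
pose d := (`|x - p| + r) / 2.
have [xd dr] : `|x - p| < d /\ d < r by rewrite /d; lra.
have d0 : 0 <= d by exact: le_trans (ltW xd).
pose K : set 'rV[R]_m := [set z | `|p - z| <= d].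
have KB : K `<=` B.
  by move=> z Kz; rewrite /B -ball_normE /=; exact: le_lt_trans dr.
have cK : compact K.
  apply: bounded_closed_compact; last exact: closed_closed_ball_.
  exists (`|p| + d); split; first exact: num_real.
  move=> M pM z Kz; apply: le_trans (ltW pM).
  by rewrite /= -[z](subKr p) (le_trans (ler_normB _ _))// lerD2l.
pose Phi z := \sum_k (`|v 0 k| * `|mu k z| + d * `|dmu k z v|).
have cPhi : {within K, continuous Phi}.
  apply: continuous_in_subspaceT => z; rewrite inE => /KB Bz.
  apply: continuous_bigsum => k _.
  have cn (f : 'rV[R]_m -> R) : {for z, continuous f} -> {for z, continuous (fun z => `|f z|)}.
    by move=> cf; apply: (@continuous_comp _ _ _ f Num.norm) => //; exact: norm_continuous.
  have cc (c : R) : {for z, continuous (fun=> c)} by exact: cst_continuous.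
  exact: (continuousD (continuousM (cc _) (cn _ (@cont_mu k z Bz)))
                      (continuousM (cc _) (cn _ (@cont_dmu k v z Bz)))).
have [|c _ Phi_max] := EVT_max_rV _ cK cPhi.
  by exists p; rewrite /K /= subrr normr0.
pose e := (d - `|x - p|) / (`|v| + 1).
have v0 := normr_ge0 v.
have e0 : 0 < e by rewrite divr_gt0 ?subr_gt0// ltr_wpDl.
have near_x (s : R) : s \in `]- e, e[ -> `|s *: v + x - p| <= d.
  rewrite in_itv /= => /andP[s1 s2].
  have se : `|s| <= e by rewrite ler_norml !ltW.
  rewrite -addrA (le_trans (ler_normD _ _))// normrZ -lerBrDr.
  rewrite (le_trans (ler_wpM2r v0 se))// /e -mulrA ler_piMr// ?subr_ge0 1?ltW//.
  by rewrite mulrC ltr_pdivrMr ?mul1r ?ltrDl// ltr_wpDl.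
have inK (s t : R) : s \in `]- e, e[ -> t \in `[0, 1] -> K (p + t *: (s *: v + x - p)).
  by move=> hs; rewrite in_itv /= => ht; apply: inB => //; exact: near_x.
pose f (s t : R) := radial_integrand (s *: v + x) t.
have df (s t : R) : s \in `]- e, e[ -> t \in `[0, 1] ->
    is_derive s 1 (f ^~ t) (dintegrand v (s *: v + x) t).
  by move=> hs ht; apply: is_derive_integrand; apply: KB; exact: inK.
have I0 : `]- e, e[%classic (0 : R) by rewrite /= in_itv /= oppr_lt0 e0.
have intf (s : R) : `]- e, e[%classic s -> leb.-integrable `[0, 1] (EFin \o f s).
  move=> hs; apply: continuous_compact_integrable; first exact: segment_compact.
  apply: continuous_in_subspaceT => t; rewrite inE /= => ht.
  have Bz := KB _ (inK s t hs ht).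
  apply: continuous_bigsum => k _.
  have cc (a : R) : {for t, continuous (fun=> a)} by exact: cst_continuous.
  exact: (continuousM (cc _) (@line_continuous (mu k) _ t (@cont_mu k) Bz)).
have derf (s t : R) : `]- e, e[%classic s -> `[0, 1]%classic t -> derivable (f ^~ t) s 1.
  by move=> hs ht; have [] := df s t hs ht.
have G0 (t : R) : 0 <= Phi c.
  by apply: sumr_ge0 => k _; rewrite addr_ge0// mulr_ge0.
have intG : leb.-integrable `[0, 1] (EFin \o (fun _ : R => Phi c)).
  apply: continuous_compact_integrable; first exact: segment_compact.
  by apply: continuous_subspaceT; exact: cst_continuous.
have d1f (s t : R) : s \in `]- e, e[ -> t \in `[0, 1] ->
    partial1of2 f s t = dintegrand v (s *: v + x) t.
  by move=> hs ht; rewrite partial1of2E; have [_] := df s t hs ht.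
have Gub (s t : R) : `]- e, e[%classic s -> `[0, 1]%classic t ->
    `|partial1of2 f s t| <= Phi c.
  move=> hs ht; rewrite d1f//; have Kz := inK s t hs ht.
  apply: le_trans (Phi_max _ (mem_set Kz)).
  rewrite /dintegrand /Phi (le_trans (ler_norm_sum _ _ _))//; apply: ler_sum => k _.
  rewrite (le_trans (ler_normD _ _))// !normrM lerD2l ler_pM// ?mulr_ge0//.
    by rewrite (le_trans (norm_entry _ _))//; exact: near_x.
  by move: ht; rewrite /= in_itv /= => /andP[t0 t1]; rewrite ger0_norm// ler_piMl.
have D : derivable (fun s => \int[leb]_(t in `[0, 1]) f s t) 0 1.
  exact: (@derivable_under_integral R _ _ leb f _ _ 0 _ _ I0 intf derf (fun=> Phi c)).
have E : 'D_1 (fun s : R => \int[leb]_(t in `[0, 1]) f s t) 0 =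
    \int[leb]_(t in `[0, 1]) partial1of2 f 0 t.
  rewrite -derive1E; exact: (@differentiation_under_integral R _ _ leb f _ _ 0 _ _ I0 intf derf (fun=> Phi c)).
have FE : (fun s : R => \int[leb]_(t in `[0, 1]) f s t) =
    (fun h : R => primitive (h *: v + x)) by [].
rewrite FE in D E; split; first exact: (proj2 (derivable1P primitive x v) D).
rewrite derive_lineE.
apply: etrans E _; rewrite -dintegrand_exact; last first.
  by rewrite /B -ball_normE /= distrC.
apply: eq_Rintegral => t; rewrite inE => ht.
by apply: etrans (d1f 0 t I0 ht) _; rewrite scale0r add0r.
Qed.

(** By the mean value theorem the increment of the primitive is the value of the
    form at an intermediate point, which is close to its value at x. *)
Lemma primitive_differentiable (x : 'rV[R]_m) : B x -> differentiable primitive x.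
Proof.
move=> Bx; pose L : {linear 'rV[R]_m -> R} := lincomb (mu^~ x).
apply: (@differentiable_approx _ _ _ _ _ L); first exact: lincomb_continuous.
move=> e e0.
pose Psi z := \sum_k `|mu k z - mu k x|.
have cPsi : {for x, continuous Psi}.
  apply: continuous_bigsum => k _.
  have cx : {for x, continuous (fun=> mu k x)} by exact: cst_continuous.
  apply: (@continuous_comp _ _ _ (fun z => mu k z - mu k x) Num.norm).
    exact: (continuousB (@cont_mu k x Bx) cx).
  exact: norm_continuous.
have : nbhs x (B `&` [set z | `|Psi x - Psi z| < e]).
  apply: filterI; first exact: open_nbhs_nbhs.
  by have /cvgrPdist_lt := cPsi; apply.
move=> /nbhs_ballP[d /= d0 sub].
apply/nbhs_ballP; exists d => //= h; rewrite -ball_normE /= sub0r normrN => hd.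
have seg (t : R) : 0 <= t <= 1 -> ball x d (x + t *: h).
  move=> /andP[t0 t1]; rewrite -ball_normE /= opprD addNKr normrN normrZ ger0_norm//.
  by rewrite (le_lt_trans (ler_piMl _ t1)).
have [t t01|t t01 E] := @MVT_line R _ primitive x h.
  by have [] := is_derive_primitive h (sub _ (seg t t01)).1.
have [Bz Psiz] := sub _ (seg t t01).
rewrite [h + x]addrC E; have [_ ->] := is_derive_primitive h Bz.
rewrite /lincomb -sumrB (le_trans (ler_norm_sum _ _ _))//.
have Psix : Psi x = 0 by rewrite /Psi big1// => k _; rewrite subrr normr0.
have Psi0 z : 0 <= Psi z by apply: sumr_ge0.
move: Psiz; rewrite /= Psix sub0r normrN ger0_norm// => /ltW Psie.
apply: le_trans (ler_wpM2r (normr_ge0 h) Psie).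
rewrite /Psi mulr_suml; apply: ler_sum => k _.
by rewrite -mulrBr normrM mulrC ler_wpM2l// norm_entry.
Qed.

Lemma partial_primitive k (x : 'rV[R]_m) : B x -> partial k primitive x = mu k x.
Proof.
move=> Bx; have [_] := is_derive_primitive (delta_mx 0 k) Bx; rewrite /partial => ->.
rewrite /lincomb (bigD1 k)//= mxE !eqxx mul1r big1 ?addr0// => j jk.
by rewrite mxE (negbTE jk) andbF mul0r.
Qed.

End poincare.

(** * Smooth functions and bilinear algebra *)

Section smooth_theory.
Variables (R : realType) (m : nat) (U : set 'rV[R]_m).
Hypothesis openU : open U.

Lemma smooth_diff (W : normedModType R) (f : 'rV[R]_m -> W) x :
  smooth U f -> U x -> differentiable f x.
Proof. by move=> sf; exact: class_C_diff (sf 1%N). Qed.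

Lemma smooth_partial (W : normedModType R) k (f : 'rV[R]_m -> W) :
  smooth U f -> smooth U (partial k f).
Proof. by move=> sf r; have [_] := sf r.+1; apply. Qed.

Lemma smooth_mxP n1 n2 (f : 'rV[R]_m -> 'M[R]_(n1, n2)) :
  smooth U f <-> forall i j, smooth U (fun x => f x i j : R).
Proof.
split=> [sf i j r|sf r]; first exact: ((class_C_mxP openU r f).1 (sf r) i j).
by apply/class_C_mxP => // i j; exact: sf.
Qed.

End smooth_theory.

Section bilinear.
Variables (R : realType) (n : nat).
Implicit Types (G : 'M[R]_n) (u v w : 'rV[R]_n).

Lemma dotE G v w : dot G v w = \sum_a \sum_b v 0 a * G a b * w 0 b.
Proof.
rewrite /dot !mxE exchange_big; apply: eq_bigr => b _.
by rewrite !mxE mulr_suml.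
Qed.

Lemma dotDl G u v w : dot G (u + v) w = dot G u w + dot G v w.
Proof. by rewrite /dot !mulmxDl mxE. Qed.

Lemma dotDr G u v w : dot G u (v + w) = dot G u v + dot G u w.
Proof. by rewrite /dot linearD mulmxDr mxE. Qed.

Lemma dotZl G a v w : dot G (a *: v) w = a * dot G v w.
Proof. by rewrite /dot -!scalemxAl mxE. Qed.

Lemma dotZr G a v w : dot G v (a *: w) = a * dot G v w.
Proof. by rewrite /dot linearZ -scalemxAr mxE. Qed.

Lemma dotNl G v w : dot G (- v) w = - dot G v w.
Proof. by rewrite -scaleN1r dotZl mulN1r. Qed.

Lemma dotBl G u v w : dot G (u - v) w = dot G u w - dot G v w.
Proof. by rewrite dotDl dotNl. Qed.

Lemma dotC G v w : G^T = G -> dot G v w = dot G w v.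
Proof.
move=> GT; rewrite !dotE exchange_big; apply: eq_bigr => b _; apply: eq_bigr => a _.
by rewrite -{1}GT mxE mulrC mulrA mulrAC -mulrA mulrC -mulrA mulrC.
Qed.

Lemma dot_suml G (I : Type) (s : seq I) (P : pred I) (F : I -> 'rV[R]_n) w :
  dot G (\sum_(i <- s | P i) F i) w = \sum_(i <- s | P i) dot G (F i) w.
Proof.
by apply: (big_morph (fun v => dot G v w)) => [u v|]; [exact: dotDl|rewrite /dot !mul0mx mxE].
Qed.

Definition quadrilinear (L : 'I_n -> 'I_n -> 'I_n -> 'I_n -> R) (X Y Z W : 'rV[R]_n) : R :=
  \sum_a \sum_b \sum_c \sum_d L a b c d * X 0 a * Y 0 b * Z 0 c * W 0 d.

Lemma quadrilinearDl L X X' Y Z W :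
  quadrilinear L (X + X') Y Z W = quadrilinear L X Y Z W + quadrilinear L X' Y Z W.
Proof.
rewrite /quadrilinear -big_split; apply: eq_bigr => a _.
rewrite -big_split; apply: eq_bigr => b _; rewrite -big_split; apply: eq_bigr => c _.
by rewrite -big_split; apply: eq_bigr => d _ /=; rewrite mxE; ring.
Qed.

Lemma quadrilinearDr L X Y Z W W' :
  quadrilinear L X Y Z (W + W') = quadrilinear L X Y Z W + quadrilinear L X Y Z W'.
Proof.
rewrite /quadrilinear -big_split; apply: eq_bigr => a _.
rewrite -big_split; apply: eq_bigr => b _; rewrite -big_split; apply: eq_bigr => c _.
by rewrite -big_split; apply: eq_bigr => d _ /=; rewrite mxE; ring.
Qed.

Lemma quadrilinear_skew L X Y Z W : (forall a b c d, L b a c d = - L a b c d) ->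
  quadrilinear L Y X Z W = - quadrilinear L X Y Z W.
Proof.
move=> skewL; rewrite /quadrilinear exchange_big -sumrN; apply: eq_bigr => a _.
rewrite -sumrN; apply: eq_bigr => b _; rewrite -sumrN; apply: eq_bigr => c _.
by rewrite -sumrN; apply: eq_bigr => d _; rewrite skewL; ring.
Qed.

(** The four sums are grouped into two sums over pairs of indices, which are then
    exchanged. *)
Lemma quadrilinear_pair L X Y Z W : (forall a b c d, L c d a b = L a b c d) ->
  quadrilinear L Z W X Y = quadrilinear L X Y Z W.
Proof.
move=> pairL; rewrite /quadrilinear.
transitivity (\sum_(p : 'I_n * 'I_n) \sum_(q : 'I_n * 'I_n)
   L p.1 p.2 q.1 q.2 * Z 0 p.1 * W 0 p.2 * X 0 q.1 * Y 0 q.2).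
  rewrite pair_bigA; apply: eq_bigr => p _; exact: pair_bigA.
rewrite exchange_big /=; symmetry.
rewrite pair_bigA; apply: eq_bigr => p _; rewrite pair_bigA; apply: eq_bigr => q _ /=.
by rewrite (pairL p.1 p.2); ring.
Qed.

End bilinear.

(** * The curvature tensor in coordinates *)

Section chart_geometry.
Variables (R : realType) (n : nat) (G : 'rV[R]_n -> 'M[R]_n) (O : set 'rV[R]_n).
Hypothesis openO : open O.
Hypothesis smoothG : smooth O G.
Hypothesis symG : forall x, O x -> (G x)^T = G x.
Hypothesis posG : forall x v, O x -> v != 0 -> 0 < dot (G x) v v.
Implicit Types (x v w : 'rV[R]_n) (a b c d e : 'I_n).

Notation Gam := (christoffel G).

Lemma metric_unit x : O x -> G x \in unitmx.
Proof.
move=> Ox; rewrite -row_free_unit -kermx_eq0; apply/rowV0P => v /sub_kermxP vG0.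
apply/eqP; apply: contraT => v0; have := posG Ox v0.
by rewrite /dot vG0 mul0mx mxE ltxx.
Qed.

Lemma metric_coefC a b x : O x -> G x a b = G x b a.
Proof. by move=> Ox; rewrite -{1}(symG Ox) mxE. Qed.

Lemma smooth_metric_coef a b : smooth O (fun x => G x a b : R).
Proof. by have /smooth_mxP := smoothG; apply. Qed.

Let dG a b : 'I_n -> 'rV[R]_n -> R := fun c => partial c (fun y => (G y a b : R)).

Let smooth_dG a b c : smooth O (dG a b c).
Proof. by apply: smooth_partial; exact: smooth_metric_coef. Qed.

Let dG_sym a b c x : O x -> dG a b c x = dG b a c x.
Proof.
move=> Ox; apply: partial_near; apply: (open_near_eq openO) Ox => y Oy.
by rewrite -{1}(symG Oy) mxE.
Qed.

Lemma smooth_christoffel a b c : smooth O (Gam a b c).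
Proof.
move=> r; apply: class_CM => //; first exact: class_C_cst.
apply: class_C_sum => // d _; apply: class_CM => //.
  by apply: (class_C_mxP openO r (fun x => invmx (G x))).1; apply: class_C_invmx => //;
    exact: metric_unit.
by apply: class_CD => //; [apply: class_CD => //|apply: class_CN => //];
  exact: smooth_dG.
Qed.

(** The Christoffel symbols of the first kind. *)
Definition christoffel1 a b c x : R :=
  2^-1 * (partial a (fun y => (G y b c : R)) x + partial b (fun y => (G y a c : R)) x
          - partial c (fun y => (G y a b : R)) x).

Lemma christoffel_lower a b d x : O x ->
  \sum_e Gam a b e x * G x e d = christoffel1 a b d x.
Proof.
move=> Ox; rewrite /christoffel1 /christoffel -/(dG b d a x) -/(dG a d b x) -/(dG a b d x).
set X := fun d => dG b d a x + dG a d b x - dG a b d x.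
transitivity (\sum_e \sum_d' 2^-1 * (invmx (G x) e d' * X d') * G x e d).
  by apply: eq_bigr => e _; rewrite mulr_sumr mulr_suml.
rewrite exchange_big /=.
transitivity (\sum_d' 2^-1 * X d' * (G x *m invmx (G x)) d d').
  apply: eq_bigr => d' _; rewrite mxE mulr_sumr; apply: eq_bigr => e _.
  by rewrite (metric_coefC e d Ox); ring.
rewrite (mulmxV (metric_unit Ox)) (bigD1 d)//= mxE eqxx mulr1 big1 ?addr0// => e ed.
by rewrite mxE eq_sym (negbTE ed) mulr0.
Qed.

Lemma christoffel_sym a b c x : O x -> Gam a b c x = Gam b a c x.
Proof.
move=> Ox; rewrite /christoffel; congr (_ * _); apply: eq_bigr => d _; congr (_ * _).
by rewrite -/(dG a b d x) (dG_sym a b d Ox) (addrC (partial a _ x)).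
Qed.

Lemma connection_form_sym x v w : O x ->
  connection_form G x v w = connection_form G x w v.
Proof.
move=> Ox; apply/rowP => c; rewrite !mxE exchange_big; apply: eq_bigr => b _.
by apply: eq_bigr => a _; rewrite christoffel_sym// mulrAC.
Qed.

(** Lowering an index removes the inverse of the metric: inner products of
    covariant derivatives only involve Christoffel symbols of the first kind. *)
Lemma dot_connection_form x v w z : O x ->
  dot (G x) (connection_form G x v w) z =
  \sum_a \sum_b \sum_c christoffel1 a b c x * v 0 a * w 0 b * z 0 c.
Proof.
move=> Ox; rewrite dotE exchange_big /=.
transitivity (\sum_c \sum_a \sum_b christoffel1 a b c x * v 0 a * w 0 b * z 0 c); last first.
  by rewrite exchange_big; apply: eq_bigr => a _; rewrite exchange_big.
apply: eq_bigr => c _.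
transitivity (\sum_e \sum_a \sum_b Gam a b e x * G x e c * (v 0 a * w 0 b * z 0 c)).
  apply: eq_bigr => e _; rewrite mxE !mulr_suml; apply: eq_bigr => a _.
  by rewrite !mulr_suml; apply: eq_bigr => b _; ring.
rewrite exchange_big; apply: eq_bigr => a _; rewrite exchange_big; apply: eq_bigr => b _.
by rewrite -mulr_suml christoffel_lower//; ring.
Qed.

Lemma partial_metric a b c x : O x ->
  partial c (fun y => (G y a b : R)) x = christoffel1 c a b x + christoffel1 c b a x.
Proof.
move=> Ox; rewrite /christoffel1 -/(dG a b c x) -/(dG c b a x) -/(dG c a b x).
by rewrite -/(dG b a c x) (dG_sym b a c Ox); lra.
Qed.

(** The curvature tensor with all indices down, which is where its pair symmetry
    can be seen. *)
Definition curvature_lower x a b c d : R :=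
  \sum_e curvature_coef G a b c e x * G x e d.

Lemma dot_curvature x X Y Z W :
  dot (G x) (curvature G x X Y Z) W = quadrilinear (curvature_lower x) X Y Z W.
Proof.
rewrite dotE exchange_big /=.
transitivity (\sum_d \sum_a \sum_b \sum_c
    curvature_lower x a b c d * X 0 a * Y 0 b * Z 0 c * W 0 d).
  apply: eq_bigr => d _.
  transitivity (\sum_e \sum_a \sum_b \sum_c
    curvature_coef G a b c e x * G x e d * (X 0 a * Y 0 b * Z 0 c * W 0 d)).
    apply: eq_bigr => e _; rewrite mxE !mulr_suml; apply: eq_bigr => a _.
    rewrite !mulr_suml; apply: eq_bigr => b _; rewrite !mulr_suml.
    by apply: eq_bigr => c _; ring.
  rewrite exchange_big; apply: eq_bigr => a _; rewrite exchange_big.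
  apply: eq_bigr => b _; rewrite exchange_big; apply: eq_bigr => c _.
  by rewrite -mulr_suml /curvature_lower; ring.
rewrite exchange_big; apply: eq_bigr => a _; rewrite exchange_big.
by apply: eq_bigr => b _; rewrite exchange_big.
Qed.

Lemma curvature_lower_skew x a b c d : curvature_lower x b a c d = - curvature_lower x a b c d.
Proof.
rewrite /curvature_lower -sumrN; apply: eq_bigr => e _; rewrite -mulNr; congr (_ * _).
rewrite /curvature_coef !opprD opprK -sumrN [- _ + _]addrC; congr (_ + _).
by apply: eq_bigr => f _; rewrite opprB.
Qed.

Definition christoffel_product a b c d x : R :=
  \sum_e Gam a b e x * christoffel1 c d e x.

Notation Q := christoffel_product.

Let Q_sym a b c d x : O x -> Q a b c d x = Q c d a b x.
Proof.
move=> Ox; rewrite /christoffel_product.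
transitivity (\sum_e \sum_f Gam a b e x * (Gam c d f x * G x f e)).
  by apply: eq_bigr => e _; rewrite -christoffel_lower// mulr_sumr.
rewrite exchange_big; apply: eq_bigr => f _; rewrite -christoffel_lower// mulr_sumr.
by apply: eq_bigr => e _; rewrite (metric_coefC f e Ox); ring.
Qed.

(** The lowered index is moved inside the derivative with the product rule, and the
    derivative of the metric that appears cancels one of the quadratic terms. *)
Let half_lower a b c d x : O x ->
  \sum_e (partial a (Gam b c e) x + \sum_f Gam b c f x * Gam a f e x) * G x e d =
  partial a (christoffel1 b c d) x - Q b c a d x.
Proof.
move=> Ox.
have dGam e : differentiable (Gam b c e) x by exact: smooth_diff (smooth_christoffel b c e) Ox.
have dGx e : differentiable (fun y => G y e d : R) x.
  exact: smooth_diff (smooth_metric_coef e d) Ox.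
have -> : partial a (christoffel1 b c d) x =
    \sum_e (partial a (Gam b c e) x * G x e d +
            Gam b c e x * (christoffel1 a e d x + christoffel1 a d e x)).
  transitivity (partial a (fun y => \sum_e Gam b c e y * G y e d) x).
    apply: partial_near; apply: (open_near_eq openO) Ox => y Oy.
    by rewrite christoffel_lower.
  rewrite partial_sum => [|e _]; last exact: differentiableMf.
  apply: eq_bigr => e _; apply: etrans (partialM a (dGam e) (dGx e)) _.
  by rewrite -(partial_metric e d a Ox).
transitivity (\sum_e partial a (Gam b c e) x * G x e d +
   \sum_f Gam b c f x * christoffel1 a f d x).
  transitivity (\sum_e (partial a (Gam b c e) x * G x e d +
      \sum_f Gam b c f x * (Gam a f e x * G x e d))).
    apply: eq_bigr => e _; rewrite mulrDl mulr_suml; congr (_ + _).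
    by apply: eq_bigr => f _; rewrite mulrA.
  rewrite big_split /=; congr (_ + _); rewrite exchange_big; apply: eq_bigr => f _.
  by rewrite -mulr_sumr christoffel_lower.
rewrite /christoffel_product -sumrB -big_split; apply: eq_bigr => e _ /=.
by move: (partial a _ x) (christoffel1 a e d x) (christoffel1 a d e x) => P1 P2 P3; ring.
Qed.

Lemma curvature_lowerE a b c d x : O x ->
  curvature_lower x a b c d =
  (partial a (christoffel1 b c d) x - Q b c a d x)
  - (partial b (christoffel1 a c d) x - Q a c b d x).
Proof.
move=> Ox; apply: esym.
apply: etrans (congr2 (fun s t => s - t) (esym (half_lower a b c d Ox))
  (esym (half_lower b a c d Ox))) _.
rewrite -sumrB; apply: eq_bigr => e _; rewrite /curvature_coef big_split /= sumrN -mulrBl; congr (_ * _).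
by move: (partial a _ x) (partial b _ x) => P1 P2; ring.
Qed.

Let H a b c d x := partial a (partial b (fun y => G y c d : R)) x.

Let partial_christoffel1 a b c d x : O x ->
  partial a (christoffel1 b c d) x = 2^-1 * (H a b c d x + H a c b d x - H a d b c x).
Proof.
move=> Ox; have dd e f g : differentiable (dG e f g) x by exact: smooth_diff (smooth_dG e f g) Ox.
have dP := differentiableDf (dd c d b) (dd b d c).
apply: etrans (partialMl a 2^-1 (differentiableDf dP (differentiableNf (dd b c d)))) _.
congr (_ * _); apply: etrans (partialD a dP (differentiableNf (dd b c d))) _.
congr (_ + _); first exact: (partialD a (dd c d b) (dd b d c)).
exact: (partialN a (dd b c d)).
Qed.

(** Here h stands for the second derivatives of the metric and q for the products
    of Christoffel symbols; the pair symmetry is a formal consequence of the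
    symmetries of each. *)
Let pair_symmetry (h q : 'I_n -> 'I_n -> 'I_n -> 'I_n -> R) a b c d :
  (forall a b c d, h a b c d = h b a c d) -> (forall a b c d, h a b c d = h a b d c) ->
  (forall a b c d, q a b c d = q b a c d) -> (forall a b c d, q a b c d = q c d a b) ->
  2^-1 * (h c d a b + h c a d b - h c b d a) - q d a c b
   - (2^-1 * (h d c a b + h d a c b - h d b c a) - q c a d b) =
  2^-1 * (h a b c d + h a c b d - h a d b c) - q b c a d
   - (2^-1 * (h b a c d + h b c a d - h b d a c) - q a c b d).
Proof.
move=> h1 h2 q1 q2.
rewrite (h1 c a) (h1 d b) (h1 c b) (h1 d a) (h1 d c) (h1 b a).
rewrite (h2 a c d b) (h2 b c d a) (h2 a d c b) (h2 b d c a).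
have q3 i j k l : q i j k l = q i j l k by rewrite q2 q1 q2.
by rewrite (q1 d a) (q2 a d) (q1 c b) (q1 c a) (q3 a c d b); ring.
Qed.

(** After lowering, the curvature is a combination of second derivatives of the
    metric and of products of Christoffel symbols, both visibly invariant under
    the exchange of the two pairs of indices. *)
Lemma curvature_lower_pair x a b c d : O x ->
  curvature_lower x c d a b = curvature_lower x a b c d.
Proof.
move=> Ox; rewrite (curvature_lowerE c d a b Ox) (curvature_lowerE a b c d Ox).
rewrite (partial_christoffel1 c d a b Ox) (partial_christoffel1 d c a b Ox).
rewrite (partial_christoffel1 a b c d Ox) (partial_christoffel1 b a c d Ox).
apply: (pair_symmetry (h := fun a b c d => H a b c d x) (q := fun a b c d => Q a b c d x)).
- by move=> e f g h; exact: (partialC e f openO (smooth_metric_coef g h 2) Ox).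
- move=> e f g h; apply: partial_near; apply: (open_near_eq openO) Ox => y Oy.
  exact: dG_sym.
- by move=> e f g h; apply: eq_bigr => i _; rewrite christoffel_sym.
- by move=> e f g h; exact: Q_sym.
Qed.

End chart_geometry.

(** * Constant curvature *)

Section constant_curvature.
Variables (R : realType) (n : nat) (G : 'rV[R]_n -> 'M[R]_n) (O : set 'rV[R]_n).
Hypothesis openO : open O.
Hypothesis smoothG : smooth O G.
Hypothesis symG : forall x, O x -> (G x)^T = G x.
Hypothesis posG : forall x v, O x -> v != 0 -> 0 < dot (G x) v v.
Variable L0 : R.
Hypothesis constG : forall x (X Y : 'rV[R]_n), O x -> row_free (col_mx X Y) ->
  sectional_curvature G x X Y = L0.

Lemma orthogonal_row_free x (X Y : 'rV[R]_n) : O x ->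
  dot (G x) X Y = 0 -> X != 0 -> Y != 0 -> row_free (col_mx X Y).
Proof.
move=> Ox XY X0 Y0; rewrite -kermx_eq0; apply/rowV0P => v /sub_kermxP.
rewrite -[v]hsubmxK mul_row_col => E.
move: E; rewrite [lsubmx v]mx11_scalar [rsubmx v]mx11_scalar !mul_scalar_mx => E.
move: (lsubmx v 0 0) (rsubmx v 0 0) E => a b E.
have dot0 z : dot (G x) (a *: X + b *: Y) z = 0 by rewrite E /dot !mul0mx mxE.
have a0 : a = 0.
  have /eqP := dot0 X; rewrite dotDl !dotZl [dot _ Y X]dotC ?symG// XY mulr0 addr0.
  by rewrite mulf_eq0 (gt_eqF (posG Ox X0)) orbF => /eqP.
have b0 : b = 0.
  have /eqP := dot0 Y; rewrite dotDl !dotZl XY mulr0 add0r.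
  by rewrite mulf_eq0 (gt_eqF (posG Ox Y0)) orbF => /eqP.
by rewrite a0 b0 !raddf0 row_mx0.
Qed.

Lemma curvature_orthogonal x (X Y : 'rV[R]_n) : O x ->
  dot (G x) X Y = 0 -> X != 0 -> Y != 0 ->
  quadrilinear (curvature_lower G x) X Y Y X = L0 * dot (G x) X X * dot (G x) Y Y.
Proof.
move=> Ox XY X0 Y0; rewrite -(constG Ox (orthogonal_row_free Ox XY X0 Y0)).
rewrite /sectional_curvature XY expr0n /= subr0 dot_curvature -mulrA divfK//.
by rewrite mulf_neq0// lt0r_neq0// posG.
Qed.

(** Polarization of the sectional curvature in its first argument: the vectors X,
    Z and X + Z are orthogonal to Y, and the two mixed terms that X + Z produces
    are equal by pair symmetry. *)
Lemma curvature_mixed x (X Y Z : 'rV[R]_n) : O x ->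
  dot (G x) X Y = 0 -> dot (G x) Z Y = 0 -> dot (G x) X Z = 0 ->
  X != 0 -> Y != 0 -> Z != 0 ->
  quadrilinear (curvature_lower G x) X Y Y Z = 0.
Proof.
move=> Ox XY ZY XZ X0 Y0 Z0.
have sG := symG Ox.
have ZX : dot (G x) Z X = 0 by rewrite dotC.
have S0 : X + Z != 0.
  apply: contraTneq (posG Ox X0) => XZ0.
  have : dot (G x) X (X + Z) = 0 by rewrite XZ0 /dot linear0 mulmx0 mxE.
  by rewrite dotDr XZ addr0 => ->; rewrite ltxx.
have skew a b c d := curvature_lower_skew G x a b c d.
have pair a b c d := curvature_lower_pair openO smoothG symG posG a b c d Ox.
have SY : dot (G x) (X + Z) Y = 0 by rewrite dotDl XY ZY addr0.
have := curvature_orthogonal Ox SY S0 Y0.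
rewrite quadrilinearDl !quadrilinearDr (curvature_orthogonal Ox XY)//.
rewrite (curvature_orthogonal Ox ZY)// !dotDl !dotDr XZ ZX.
have -> : quadrilinear (curvature_lower G x) Z Y Y X = quadrilinear (curvature_lower G x) X Y Y Z.
  rewrite -(quadrilinear_pair _ _ _ _ pair) (quadrilinear_skew _ _ _ _ skew).
  rewrite -(quadrilinear_pair _ _ _ _ pair) (quadrilinear_skew _ _ _ _ skew) opprK.
  by rewrite (quadrilinear_pair _ _ _ _ pair).
move: (quadrilinear _ _ _ _ _) (dot _ X X) (dot _ Y Y) (dot _ Z Z) => q x1 x2 x3; lra.
Qed.

Lemma curvature_mixed' x (X Y Z : 'rV[R]_n) : O x ->
  dot (G x) X Y = 0 -> dot (G x) Z Y = 0 -> dot (G x) X Z = 0 ->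
  X != 0 -> Y != 0 -> Z != 0 ->
  quadrilinear (curvature_lower G x) X Y Z Y = 0.
Proof.
move=> Ox XY ZY XZ X0 Y0 Z0.
have skew a b c d := curvature_lower_skew G x a b c d.
have pair a b c d := curvature_lower_pair openO smoothG symG posG a b c d Ox.
rewrite -(quadrilinear_pair _ _ _ _ pair) (quadrilinear_skew _ _ _ _ skew).
by rewrite (quadrilinear_pair _ _ _ _ pair) curvature_mixed// oppr0.
Qed.

End constant_curvature.

(** * Covariant derivatives along a map *)

Section along_a_map.
Variables (R : realType) (n m : nat) (G : 'rV[R]_n -> 'M[R]_n) (O : set 'rV[R]_n).
Hypothesis openO : open O.
Hypothesis smoothG : smooth O G.
Hypothesis symG : forall x, O x -> (G x)^T = G x.
Hypothesis posG : forall x v, O x -> v != 0 -> 0 < dot (G x) v v.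
Variables (U : set 'rV[R]_m) (y : 'rV[R]_m -> 'rV[R]_n).
Hypothesis openU : open U.
Hypothesis smoothy : smooth U y.
Hypothesis yO : forall p, U p -> O (y p).
Implicit Types (p : 'rV[R]_m) (k l : 'I_m) (V W : 'rV[R]_m -> 'rV[R]_n).

(** The pull-back along y of the Levi-Civita connection of G. *)
Definition cov k V : 'rV[R]_m -> 'rV[R]_n := fun p =>
  partial k V p + connection_form G (y p) (partial k y p) (V p).

Lemma connection_formE x v w d : (connection_form G x v w) 0 d =
  \sum_a \sum_b christoffel G a b d x * v 0 a * w 0 b.
Proof. by rewrite mxE. Qed.

Lemma connection_formDr x v w w' : connection_form G x v (w + w') =
  connection_form G x v w + connection_form G x v w'.
Proof.
apply/rowP => d; rewrite [RHS]mxE !connection_formE -big_split; apply: eq_bigr => a _.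
by rewrite -big_split; apply: eq_bigr => b _ /=; rewrite mxE mulrDr.
Qed.

Lemma connection_formZr x c v w :
  connection_form G x v (c *: w) = c *: connection_form G x v w.
Proof.
apply/rowP => d; rewrite [RHS]mxE !connection_formE mulr_sumr; apply: eq_bigr => a _.
by rewrite mulr_sumr; apply: eq_bigr => b _; rewrite mxE mulrCA.
Qed.

Let smooth_Gam a b c : smooth U (fun p => christoffel G a b c (y p)).
Proof.
move=> r; apply: (class_C_comp openU (O := O)) => //.
exact: (smooth_christoffel openO smoothG posG).
Qed.

Let smooth_dy k a : smooth U (fun p => partial k y p 0 a : R).
Proof. by apply: (smooth_mxP openU (partial k y)).1; exact: smooth_partial. Qed.

Lemma smooth_cov k V : smooth U V -> smooth U (cov k V).
Proof.
move=> sV r; apply: class_CD => //; first exact: (smooth_partial k sV).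
apply/class_C_mxP => // i d; rewrite ord1.
have : class_C r U (fun p => \sum_a \sum_b
    christoffel G a b d (y p) * partial k y p 0 a * V p 0 b).
  apply: class_C_sum => // a _; apply: class_C_sum => // b _.
  apply: class_CM => //; last exact: ((smooth_mxP openU V).1 sV).
  apply: class_CM => //; [exact: smooth_Gam|exact: smooth_dy].
by apply: class_C_ext => // p _; rewrite connection_formE.
Qed.

Lemma covD k V W p : differentiable V p -> differentiable W p ->
  cov k (fun q => V q + W q) p = cov k V p + cov k W p.
Proof.
by move=> dV dW; rewrite /cov partialD// connection_formDr addrACA.
Qed.

Lemma covZ k (a : 'rV[R]_m -> R) V p : differentiable a p -> differentiable V p ->
  cov k (fun q => a q *: V q) p = partial k a p *: V p + a p *: cov k V p.
Proof.
by move=> da dV; rewrite /cov partialZ// connection_formZr scalerDr addrA.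
Qed.

Lemma cov_near k V W p : {near p, V =1 W} -> cov k V p = cov k W p.
Proof.
by move=> VW; rewrite /cov (partial_near k VW) (nbhs_singleton VW).
Qed.

(** The connection has no torsion and second partial derivatives commute. *)
Lemma cov_tangentC k l p : U p -> cov k (partial l y) p = cov l (partial k y) p.
Proof.
move=> Up; apply: (congr2 +%R (partial_mxC k l openU (smoothy 2) Up)).
exact: (connection_form_sym openO symG _ _ (yO Up)).
Qed.

Let diff_metric a b p : U p -> differentiable (fun q => G (y q) a b : R) p.
Proof.
move=> Up; apply: (@differentiable_comp _ _ _ _ y (fun z => G z a b : R)).
  exact: smooth_diff smoothy Up.
exact: smooth_diff (smooth_metric_coef openO smoothG a b) (yO Up).
Qed.

(** Metric compatibility of the pulled-back connection. *)
Lemma partial_dot k V W p : U p -> differentiable V p -> differentiable W p ->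
  partial k (fun q => dot (G (y q)) (V q) (W q)) p =
  dot (G (y p)) (cov k V p) (W p) + dot (G (y p)) (V p) (cov k W p).
Proof.
move=> Up dV dW.
have dVa a : differentiable (fun q => V q 0 a : R) p by exact: (differentiable_mxP V p).1.
have dWa a : differentiable (fun q => W q 0 a : R) p by exact: (differentiable_mxP W p).1.
have dy : differentiable y p := smooth_diff smoothy Up.
have dterm a b : differentiable (fun q => V q 0 a * G (y q) a b * W q 0 b) p.
  by apply: differentiableMf => //; apply: differentiableMf => //; exact: diff_metric.
transitivity (partial k (fun q => \sum_a \sum_b V q 0 a * G (y q) a b * W q 0 b) p).
  by congr (partial k _ p); apply/funext => q; rewrite dotE.
rewrite partial_sum => [|a _]; last exact: differentiable_bigsum.
have dG a b : partial k (fun q => G (y q) a b : R) p =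
    \sum_c partial k y p 0 c *
      (christoffel1 G c a b (y p) + christoffel1 G c b a (y p)).
  have dG' := smooth_diff (smooth_metric_coef openO smoothG a b) (yO Up).
  apply: etrans (partial_comp k dy dG') _; apply: eq_bigr => c _; congr (_ * _).
  exact: (partial_metric openO symG a b c (yO Up)).
have sG := symG (yO Up).
rewrite /cov dotDl dotDr [dot _ (V p) (connection_form _ _ _ _)]dotC//.
rewrite !(dot_connection_form symG posG _ _ _ (yO Up)).
transitivity (\sum_a \sum_b (partial k V p 0 a * G (y p) a b * W p 0 b
   + V p 0 a * partial k (fun q => G (y q) a b : R) p * W p 0 b
   + V p 0 a * G (y p) a b * partial k W p 0 b)).
  apply: eq_bigr => a _; rewrite partial_sum//; apply: eq_bigr => b _.
  have dVG := differentiableMf (dVa a) (diff_metric a b Up).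
  apply: etrans (partialM k dVG (dWa b)) _; congr (_ + _).
    rewrite -mulrDl; congr (_ * _); apply: etrans (partialM k (dVa a) (diff_metric a b Up)) _.
    by congr (_ * _ + _); apply: esym; exact: partial_mx.
  by congr (_ * _); apply: esym; exact: partial_mx.
transitivity ((\sum_a \sum_b partial k V p 0 a * G (y p) a b * W p 0 b)
  + (\sum_a \sum_b V p 0 a * partial k (fun q => G (y q) a b : R) p * W p 0 b)
  + (\sum_a \sum_b V p 0 a * G (y p) a b * partial k W p 0 b)).
  rewrite -!big_split; apply: eq_bigr => a _ /=; rewrite -!big_split.
  by apply: eq_bigr => b _.
rewrite -!dotE -!addrA; congr (_ + _); rewrite [RHS]addrCA [LHS]addrC; congr (_ + _).
transitivity (\sum_a \sum_b \sum_c (christoffel1 G c a b (y p) * partial k y p 0 c * V p 0 a * W p 0 b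
   + christoffel1 G c b a (y p) * partial k y p 0 c * W p 0 b * V p 0 a)).
  apply: eq_bigr => a _; apply: eq_bigr => b _; rewrite dG mulr_sumr mulr_suml.
  apply: eq_bigr => c _; move: (partial k y p 0 c) => Y; ring.
transitivity (\sum_a \sum_b \sum_c (christoffel1 G c a b (y p) * partial k y p 0 c * V p 0 a * W p 0 b)
   + \sum_a \sum_b \sum_c (christoffel1 G c b a (y p) * partial k y p 0 c * W p 0 b * V p 0 a)).
  rewrite -big_split; apply: eq_bigr => a _ /=; rewrite -big_split; apply: eq_bigr => b _ /=.
  by rewrite -big_split.
congr (_ + _).
  rewrite exchange_big /=; under eq_bigr do rewrite exchange_big /=.
  rewrite exchange_big /=; apply: eq_bigr => c _; exact: exchange_big.
under eq_bigr do rewrite exchange_big /=.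
rewrite exchange_big /=; apply: eq_bigr => c _; exact: exchange_big.
Qed.

(** The curvature coefficients are the antisymmetrization of [half] in a and b. *)
Let half (a b c d : 'I_n) x : R :=
  partial a (christoffel G b c d) x
  + \sum_e christoffel G b c e x * christoffel G a e d x.

(** The part of the second covariant derivative that is symmetric in k and l, by
    the symmetry of second partial derivatives; it cancels in the commutator. *)
Let symmetric_part k l V p d : R :=
  partial k (partial l V) p 0 d
  + \sum_a \sum_b christoffel G a b d (y p) * partial k (partial l y) p 0 a * V p 0 b
  + \sum_a \sum_b christoffel G a b d (y p) *
      (partial l y p 0 a * partial k V p 0 b + partial k y p 0 a * partial l V p 0 b).

Let symmetric_partC k l V p d : U p -> smooth U V ->
  symmetric_part k l V p d = symmetric_part l k V p d.
Proof.
move=> Up sV.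
have EV := congr1 (fun M : 'rV_n => M 0 d) (partial_mxC k l openU (sV 2) Up).
have Ey a := congr1 (fun M : 'rV_n => M 0 a) (partial_mxC k l openU (smoothy 2) Up).
apply: (congr2 +%R); first apply: (congr2 +%R EV).
  by apply: eq_bigr => a _; apply: eq_bigr => b _; exact: (congr1 (fun t => _ * t * _) (Ey a)).
by apply: eq_bigr => a _; apply: eq_bigr => b _; congr (_ * _); exact: addrC.
Qed.

Let cov2 k l V p d : U p -> smooth U V ->
  (cov k (cov l V) p) 0 d = symmetric_part k l V p d
  + \sum_a \sum_b \sum_c half a b c d (y p) * partial k y p 0 a * partial l y p 0 b * V p 0 c.
Proof.
move=> Up sV.
have dVa a : differentiable (fun q => V q 0 a : R) p.
  by apply: (differentiable_mxP V p).1; exact: smooth_diff sV Up.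
have dy : differentiable y p := smooth_diff smoothy Up.
have ddy := smooth_diff (smooth_partial l smoothy) Up.
have dya a : differentiable (fun q => partial l y q 0 a : R) p by exact: smooth_diff (smooth_dy l a) Up.
have dGam a b : differentiable (fun q => christoffel G a b d (y q)) p by exact: smooth_diff (smooth_Gam a b d) Up.
have dGam' a b : differentiable (christoffel G a b d) (y p).
  exact: smooth_diff (smooth_christoffel openO smoothG posG a b d) (yO Up).
have ddV := smooth_diff (smooth_partial l sV) Up.
have dcV := smooth_diff (smooth_cov l sV) Up.
rewrite {1}/cov mxE (partial_mx _ 0 d dcV) connection_formE.
have dterm a b : differentiable (fun q => christoffel G a b d (y q) * partial l y q 0 a * V q 0 b) p.
  by apply: differentiableMf => //; exact: differentiableMf.
have -> : partial k (fun q => cov l V q 0 d : R) p =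
  partial k (partial l V) p 0 d + \sum_a \sum_b (
    (\sum_c partial k y p 0 c * partial c (christoffel G a b d) (y p)) * partial l y p 0 a * V p 0 b
    + christoffel G a b d (y p) * partial k (partial l y) p 0 a * V p 0 b
    + christoffel G a b d (y p) * partial l y p 0 a * partial k V p 0 b).
  transitivity (partial k (fun q => partial l V q 0 d +
     \sum_a \sum_b christoffel G a b d (y q) * partial l y q 0 a * V q 0 b) p).
    by congr (partial k _ p); apply/funext => q; rewrite /cov mxE connection_formE.
  have dlV := (differentiable_mxP (partial l V) p).1 ddV 0 d.
  have dsum := differentiable_bigsum (index_enum 'I_n) (P := xpredT)
    (fun a _ => differentiable_bigsum (index_enum 'I_n) (P := xpredT) (fun b _ => dterm a b)).
  apply: etrans (partialD k dlV dsum) _; congr (_ + _); first by apply: esym; exact: partial_mx.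
  rewrite partial_sum => [|a _]; last exact: differentiable_bigsum.
  apply: eq_bigr => a _; rewrite partial_sum//; apply: eq_bigr => b _.
  have dGy := differentiableMf (dGam a b) (dya a).
  apply: etrans (partialM k dGy (dVa b)) _; congr (_ + _); last first.
    by congr (_ * _); apply: esym; apply: partial_mx; exact: smooth_diff sV Up.
  rewrite -mulrDl; congr (_ * _); apply: etrans (partialM k (dGam a b) (dya a)) _.
  congr (_ * _ + _ * _); first exact: partial_comp.
  by apply: esym; exact: partial_mx.
rewrite /symmetric_part -!addrA; congr (_ + _).
transitivity (
   (\sum_a \sum_b christoffel G a b d (y p) * partial k (partial l y) p 0 a * V p 0 b
    + \sum_a \sum_b christoffel G a b d (y p) *
        (partial l y p 0 a * partial k V p 0 b + partial k y p 0 a * partial l V p 0 b))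
   + (\sum_a \sum_b \sum_c partial c (christoffel G a b d) (y p) * partial k y p 0 c * partial l y p 0 a * V p 0 b
     + \sum_a \sum_e christoffel G a e d (y p) * partial k y p 0 a *
        (connection_form G (y p) (partial l y p) (V p)) 0 e)).
  rewrite -!big_split; apply: eq_bigr => a _ /=; rewrite -!big_split; apply: eq_bigr => b _ /=.
  rewrite {1}/cov mxE.
  have -> : \sum_c partial c (christoffel G a b d) (y p) * partial k y p 0 c * partial l y p 0 a * V p 0 b =
     (\sum_c partial k y p 0 c * partial c (christoffel G a b d) (y p)) * partial l y p 0 a * V p 0 b.
    rewrite !mulr_suml; apply: eq_bigr => c _.
    by congr (_ * _ * _); exact: mulrC.
  have regroup (S' L Vb g KL Vk Y Vl C : R) :
    S' * L * Vb + g * KL * Vb + g * L * Vk + g * Y * (Vl + C) =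
    g * KL * Vb + g * (L * Vk + Y * Vl) + (S' * L * Vb + g * Y * C) by ring.
  exact: regroup.
rewrite -!addrA; congr (_ + (_ + _)).
have -> : \sum_a \sum_b \sum_c half a b c d (y p) * partial k y p 0 a * partial l y p 0 b * V p 0 c =
  \sum_a \sum_b \sum_c partial a (christoffel G b c d) (y p) * partial k y p 0 a * partial l y p 0 b * V p 0 c
  + \sum_a \sum_b \sum_c (\sum_e christoffel G b c e (y p) * christoffel G a e d (y p)) * partial k y p 0 a * partial l y p 0 b * V p 0 c.
  rewrite -big_split; apply: eq_bigr => a _ /=; rewrite -big_split; apply: eq_bigr => b _ /=.
  rewrite -big_split; apply: eq_bigr => c _ /=; by rewrite -!mulrDl.
congr (_ + _).
  rewrite [RHS]exchange_big; apply: eq_bigr => b _ /=; exact: exchange_big.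
apply: eq_bigr => a _.
transitivity (\sum_e \sum_b \sum_c christoffel G b c e (y p) * christoffel G a e d (y p) * partial k y p 0 a * partial l y p 0 b * V p 0 c).
  apply: eq_bigr => e _; rewrite connection_formE mulr_sumr; apply: eq_bigr => b _.
  rewrite mulr_sumr; apply: eq_bigr => c _.
  have regroup (g g' Y L Vc : R) : g' * Y * (g * L * Vc) = g * g' * Y * L * Vc by ring.
  exact: regroup.
rewrite exchange_big; apply: eq_bigr => b _; rewrite exchange_big; apply: eq_bigr => c _ /=.
by rewrite !mulr_suml.
Qed.

(** The curvature of the pulled-back connection is the pull-back of the curvature;
    the coordinate fields commute, so no bracket term appears. *)
Lemma cov_commutator k l V p : U p -> smooth U V ->
  cov k (cov l V) p - cov l (cov k V) p =
  curvature G (y p) (partial k y p) (partial l y p) (V p).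
Proof.
move=> Up sV; apply/rowP => d.
have entryB (A B : 'rV[R]_n) : (A - B) 0 d = A 0 d - B 0 d by rewrite !mxE.
apply: etrans (entryB _ _) _.
apply: etrans (congr2 (fun s t => s - t) (cov2 k l d Up sV) (cov2 l k d Up sV)) _.
rewrite (symmetric_partC k l d Up sV) opprD addrACA subrr add0r mxE.
rewrite [X in - X]exchange_big /= -sumrB; apply: eq_bigr => a _.
rewrite -sumrB; apply: eq_bigr => b _; rewrite -sumrB; apply: eq_bigr => c _.
rewrite /half /curvature_coef.
have -> : \sum_e (christoffel G b c e (y p) * christoffel G a e d (y p) -
            christoffel G a c e (y p) * christoffel G b e d (y p)) =
   \sum_e christoffel G b c e (y p) * christoffel G a e d (y p) -
   \sum_e christoffel G a c e (y p) * christoffel G b e d (y p) by exact: sumrB.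
have regroup (P1 P2 S1 S2 Y L Vc : R) :
  (P1 + S1) * Y * L * Vc - (P2 + S2) * L * Y * Vc = (P1 - P2 + (S1 - S2)) * Y * L * Vc by ring.
exact: regroup.
Qed.

End along_a_map.

(** * Surfaces with a conformal normal frame, in one chart *)

(** The surface with its normal frame, read in one chart of the ambient manifold. The
    second fundamental form and the normal connection are recorded by inner
    products of ambient derivatives, so that no projection has to be
    differentiated. *)
Record framed_surface (R : realType) (G : 'rV[R]_4 -> 'M[R]_4) (O : set 'rV[R]_4)
    (U : set 'rV[R]_2) (y : 'rV[R]_2 -> 'rV[R]_4) (lam : 'rV[R]_2 -> R)
    (N1 N2 : 'rV[R]_2 -> 'rV[R]_4) (al be : 'I_2 -> 'I_2 -> 'rV[R]_2 -> R)
    (mu : 'I_2 -> 'rV[R]_2 -> R) : Prop := FramedSurface {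
  fs_openO : open O;
  fs_metric_smooth : smooth O G;
  fs_metric_sym : forall x, O x -> (G x)^T = G x;
  fs_metric_pos : forall x v, O x -> v != 0 -> 0 < dot (G x) v v;
  fs_openU : open U;
  fs_map_smooth : smooth U y;
  fs_mapO : forall p, U p -> O (y p);
  fs_lam_smooth : smooth U lam;
  fs_tangent : forall p k l, U p ->
    dot (G (y p)) (partial k y p) (partial l y p) = expR (2 * lam p) *+ (k == l);
  fs_smooth1 : smooth U N1;
  fs_smooth2 : smooth U N2;
  fs_normal1 : forall p k, U p -> dot (G (y p)) (N1 p) (partial k y p) = 0;
  fs_normal2 : forall p k, U p -> dot (G (y p)) (N2 p) (partial k y p) = 0;
  fs_norm1 : forall p, U p -> dot (G (y p)) (N1 p) (N1 p) = expR (2 * lam p);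
  fs_norm2 : forall p, U p -> dot (G (y p)) (N2 p) (N2 p) = expR (2 * lam p);
  fs_orth : forall p, U p -> dot (G (y p)) (N1 p) (N2 p) = 0;
  fs_al : forall p k l, U p ->
    dot (G (y p)) (cov G y k (partial l y) p) (N1 p) = expR (2 * lam p) * al k l p;
  fs_be : forall p k l, U p ->
    dot (G (y p)) (cov G y k (partial l y) p) (N2 p) = expR (2 * lam p) * be k l p;
  fs_mu : forall p k, U p ->
    dot (G (y p)) (cov G y k N1 p) (N2 p) = expR (2 * lam p) * mu k p
}.

Section framed_surface_theory.
Variables (R : realType) (G : 'rV[R]_4 -> 'M[R]_4) (O : set 'rV[R]_4).
Variables (U : set 'rV[R]_2) (y : 'rV[R]_2 -> 'rV[R]_4) (lam : 'rV[R]_2 -> R).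
Variables (N1 N2 : 'rV[R]_2 -> 'rV[R]_4) (al be : 'I_2 -> 'I_2 -> 'rV[R]_2 -> R).
Variable mu : 'I_2 -> 'rV[R]_2 -> R.
Hypothesis fs : framed_surface G O U y lam N1 N2 al be mu.
Implicit Types (p q : 'rV[R]_2) (k l : 'I_2) (v w : 'rV[R]_4).

Local Notation openO := (fs_openO fs).
Local Notation smoothG := (fs_metric_smooth fs).
Local Notation symG := (fs_metric_sym fs).
Local Notation posG := (fs_metric_pos fs).
Local Notation openU := (fs_openU fs).
Local Notation smoothy := (fs_map_smooth fs).
Local Notation yO := (fs_mapO fs).
Local Notation ip p := (dot (G (y p))).
Local Notation T k p := (partial k y p).
Local Notation E p := (expR (2 * lam p)).

Lemma fs_subset (V : set 'rV[R]_2) : open V -> V `<=` U ->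
  framed_surface G O V y lam N1 N2 al be mu.
Proof.
move=> oV VU; have sub (W : normedModType R) (f : 'rV[R]_2 -> W) : smooth U f -> smooth V f.
  by move=> sf r; exact: class_C_subset (sf r).
case: fs => *; split=> //; first exact: sub.
all: try by (move=> p; move: (VU p); auto).
all: by auto.
Qed.

Lemma ipC p v w : U p -> ip p v w = ip p w v.
Proof. by move=> Up; apply: dotC; exact/symG/yO. Qed.

Let dN1 p : U p -> differentiable N1 p := smooth_diff (fs_smooth1 fs).
Let dN2 p : U p -> differentiable N2 p := smooth_diff (fs_smooth2 fs).
Let dlam p : U p -> differentiable lam p := smooth_diff (fs_lam_smooth fs).
Let sT k : smooth U (partial k y) := smooth_partial k smoothy.
Let dT k p : U p -> differentiable (partial k y) p := smooth_diff (sT k).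

Let E_neq0 p : E p != 0. Proof. by rewrite gt_eqF// expR_gt0. Qed.

Definition frame p (i : 'I_4) : 'rV[R]_4 :=
  nth 0 [:: T uu p; T vv p; N1 p; N2 p] i.

Lemma ip_frame p (i j : 'I_4) : U p -> ip p (frame p i) (frame p j) = E p *+ (i == j).
Proof.
move=> Up.
have h := fs_tangent fs; have n1 := fs_normal1 fs; have n2 := fs_normal2 fs.
have n1' k : ip p (T k p) (N1 p) = 0 by rewrite ipC ?n1.
have n2' k : ip p (T k p) (N2 p) = 0 by rewrite ipC ?n2.
have o' : ip p (N2 p) (N1 p) = 0 by rewrite ipC// (fs_orth fs).
case: i => -[|[|[|[|//]]]] ? ; case: j => -[|[|[|[|//]]]] ? ; rewrite /frame /=;
 by rewrite ?h ?n1 ?n2 ?n1' ?n2' ?o' ?(fs_orth fs) ?(fs_norm1 fs) ?(fs_norm2 fs).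
Qed.

(** The frame is orthogonal and its four vectors have the same length: its matrix
    B satisfies B G B^T = e^(2 lam) I, hence so does the product in the other
    order, G B^T B = e^(2 lam) I. *)
Lemma parseval p v w : U p -> ip p v w = (E p)^-1 *
  (ip p v (T uu p) * ip p w (T uu p) + ip p v (T vv p) * ip p w (T vv p)
   + ip p v (N1 p) * ip p w (N1 p) + ip p v (N2 p) * ip p w (N2 p)).
Proof.
move=> Up; pose B : 'M[R]_4 := \matrix_(i, j) frame p i 0 j.
have rowB i : row i B = frame p i by apply/rowP => j; rewrite !mxE.
pose C := (E p)^-1 *: (G (y p) *m B^T).
have BC : B *m C = 1%:M.
  apply/matrixP => i j; rewrite -scalemxAr mulmxA mxE.
  have -> : (B *m G (y p) *m B^T) i j = ip p (frame p i) (frame p j).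
    by rewrite /dot -!rowB tr_row -!row_mul !mxE; apply: eq_bigr => a _; rewrite !mxE.
  by rewrite ip_frame// mxE mulrnAr mulVf.
have CB := mulmx1C BC.
have vB i : (v *m G (y p) *m B^T) 0 i = ip p v (frame p i).
  by rewrite /dot mxE [RHS]mxE; apply: eq_bigr => j _; congr (_ * _); rewrite !mxE.
have Bw i : (B *m G (y p) *m w^T) i 0 = ip p w (frame p i).
  rewrite ipC// /dot mxE [RHS]mxE; apply: eq_bigr => j _; congr (_ * _).
  by rewrite mxE [RHS]mxE; apply: eq_bigr => a _; rewrite mxE.
have -> : ip p v w = \sum_i (E p)^-1 * (ip p v (frame p i) * ip p w (frame p i)).
  have -> : ip p v w = (v *m (C *m B) *m G (y p) *m w^T) 0 0 by rewrite CB mulmx1.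
  have -> : v *m (C *m B) *m G (y p) *m w^T =
      (E p)^-1 *: ((v *m G (y p) *m B^T) *m (B *m G (y p) *m w^T)).
    by rewrite /C -!scalemxAl -!scalemxAr -!scalemxAl !mulmxA.
  by rewrite mxE [X in _ * X]mxE mulr_sumr; apply: eq_bigr => i _; rewrite vB Bw.
have regroup (e x1 x2 x3 x4 z1 z2 z3 z4 : R) :
    e * (x1 * z1) + (e * (x2 * z2) + (e * (x3 * z3) + (e * (x4 * z4) + 0))) =
    e * (x1 * z1 + x2 * z2 + x3 * z3 + x4 * z4) by ring.
by rewrite !big_ord_recl big_ord0; exact: regroup.
Qed.

Lemma orthogonal_eq0 p v : U p -> (forall k, ip p v (T k p) = 0) ->
  ip p v (N1 p) = 0 -> ip p v (N2 p) = 0 -> v = 0.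
Proof.
move=> Up vT v1 v2; apply/eqP; apply: contraT => v0; have := posG (yO Up) v0.
by rewrite parseval// !vT v1 v2 !mul0r !addr0 mulr0 ltxx.
Qed.

Lemma partial_conformal k p : U p ->
  partial k (fun q => E q) p = 2 * partial k lam p * E p.
Proof.
move=> Up; have d2 := differentiableMf (differentiable_cst (2 : R) p) (dlam Up).
apply: etrans (partial_comp1 k (is_derive_expR (2 * lam p)) d2) _.
by rewrite (partialMl k 2 (dlam Up)) mulrC.
Qed.

Let partial_const k (f : 'rV[R]_2 -> R) c p : U p -> (forall q, U q -> f q = c) ->
  partial k f p = 0.
Proof.
move=> Up fc; apply: etrans (partial_near k (open_near_eq openU fc Up)) _.
exact: partial_cst.
Qed.

Let dotd k (V W : 'rV[R]_2 -> 'rV[R]_4) p : U p -> differentiable V p -> differentiable W p ->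
  partial k (fun q => ip q (V q) (W q)) p = ip p (cov G y k V p) (W p) + ip p (V p) (cov G y k W p).
Proof. by move=> Up dV dW; exact: (partial_dot openO smoothG symG posG smoothy yO). Qed.

Section normal_field.
Variables (a b : 'rV[R]_2 -> R) (p : 'rV[R]_2).
Hypothesis Up : U p.
Hypothesis da : differentiable a p.
Hypothesis db : differentiable b p.

Definition normal_combination q : 'rV[R]_4 := a q *: N1 q + b q *: N2 q.

Let V := normal_combination.

Let dV : differentiable V p.
Proof.
by apply: differentiableDf; apply: differentiable_scale => //; [exact: dN1|exact: dN2].
Qed.

Lemma cov_normal_combination k : cov G y k V p =
  (partial k a p *: N1 p + a p *: cov G y k N1 p) +
  (partial k b p *: N2 p + b p *: cov G y k N2 p).
Proof.
apply: etrans (covD _ _ _ (differentiable_scale da (dN1 Up)) (differentiable_scale db (dN2 Up))) _.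
by rewrite (covZ _ _ _ da (dN1 Up)) (covZ _ _ _ db (dN2 Up)).
Qed.

Lemma cov_normal_tangent k l : ip p (cov G y k V p) (T l p) =
  - (E p * (a p * al k l p + b p * be k l p)).
Proof.
have : partial k (fun q => ip q (V q) (T l q)) p = 0.
  apply: (@partial_const k _ 0 p Up) => q Uq.
  by rewrite dotDl !dotZl (fs_normal1 fs)// (fs_normal2 fs)// !mulr0 addr0.
rewrite (dotd k Up dV (dT l Up)) => /eqP; rewrite addr_eq0 => /eqP ->; congr (- _).
rewrite dotDl !dotZl ![ip p _ (cov _ _ _ _ _)]ipC// (fs_al fs)// (fs_be fs)//.
by rewrite mulrDr !(mulrCA _ (E p)).
Qed.

Let norm_deriv k (V1 : 'rV[R]_2 -> 'rV[R]_4) : differentiable V1 p ->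
  (forall q, U q -> ip q (V1 q) (V1 q) = E q) ->
  ip p (cov G y k V1 p) (V1 p) = partial k lam p * E p.
Proof.
move=> dV1 nV1.
have : partial k (fun q => ip q (V1 q) (V1 q)) p = 2 * partial k lam p * E p.
  by rewrite -(partial_conformal k Up); apply: partial_near;
    apply: (open_near_eq openU) Up => q Uq; exact: nV1.
rewrite (dotd k Up dV1 dV1) [ip p (V1 p) _]ipC//.
by move: (ip p _ _) (partial k lam p) (E p) => x1 x2 x3; lra.
Qed.

Let cov21 k : ip p (cov G y k N2 p) (N1 p) = - (E p * mu k p).
Proof.
have : partial k (fun q => ip q (N1 q) (N2 q)) p = 0.
  by apply: (@partial_const k _ 0 p Up) => q Uq; rewrite (fs_orth fs).
rewrite (dotd k Up (dN1 Up) (dN2 Up)) (fs_mu fs)// [ip p (N1 p) _]ipC//.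
by move=> /eqP; rewrite addrC addr_eq0 => /eqP.
Qed.

Lemma cov_normal1 k : ip p (cov G y k V p) (N1 p) =
  E p * (partial k a p + a p * partial k lam p - b p * mu k p).
Proof.
rewrite cov_normal_combination !dotDl !dotZl (fs_norm1 fs)// [ip p (N2 p) _]ipC//.
rewrite (fs_orth fs)// cov21 (norm_deriv k (dN1 Up) (fs_norm1 fs)).
move: (partial k a p) (partial k b p) (partial k lam p) (E p) => x1 x2 x3 x4; ring.
Qed.

Lemma cov_normal2 k : ip p (cov G y k V p) (N2 p) =
  E p * (partial k b p + b p * partial k lam p + a p * mu k p).
Proof.
rewrite cov_normal_combination !dotDl !dotZl (fs_norm2 fs)// (fs_orth fs)//.
rewrite (fs_mu fs)// (norm_deriv k (dN2 Up) (fs_norm2 fs)).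
move: (partial k a p) (partial k b p) (partial k lam p) (E p) => x1 x2 x3 x4; ring.
Qed.

End normal_field.

Lemma smooth_ip (V W : 'rV[R]_2 -> 'rV[R]_4) : smooth U V -> smooth U W ->
  smooth U (fun q => ip q (V q) (W q)).
Proof.
move=> sV sW r.
have : class_C r U (fun q => \sum_a \sum_b V q 0 a * G (y q) a b * W q 0 b).
  apply: class_C_sum => [|a _]; first exact: openU.
  apply: class_C_sum => [|b _]; first exact: openU.
  apply: class_CM; first exact: openU.
    apply: class_CM; [exact: openU|exact: ((smooth_mxP openU V).1 sV)|].
    apply: (class_C_comp openU (O := O) yO (smoothy r) (g := fun x => G x a b : R)).
    exact: (smooth_metric_coef openO smoothG).
  exact: ((smooth_mxP openU W).1 sW).
by apply: class_C_ext => [|q Uq]; [exact: openU|rewrite dotE].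
Qed.

Let smooth_invE : smooth U (fun q => (E q)^-1).
Proof.
move=> r; apply: class_CV; [exact: openU|by move=> q _; exact: E_neq0|].
apply: class_C_expR; first exact: openU.
apply: class_CM; [exact: openU|apply: class_C_cst; exact: openU|exact: (fs_lam_smooth fs)].
Qed.

Lemma smooth_mu k : smooth U (mu k).
Proof.
move=> r.
have := class_CM openU (smooth_invE r)
  (smooth_ip (smooth_cov openO smoothG posG openU smoothy yO k (fs_smooth1 fs)) (fs_smooth2 fs) r).
apply: class_C_ext => [|q Uq]; first exact: openU.
by rewrite (fs_mu fs)// mulKf.
Qed.

Lemma normal_fieldE (V : 'rV[R]_2 -> 'rV[R]_4) : smooth U V ->
  (forall q k, U q -> ip q (V q) (T k q) = 0) ->
  exists a b, [/\ smooth U a, smooth U b &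
    forall q, U q -> V q = normal_combination a b q].
Proof.
move=> sV VT; exists (fun q => (E q)^-1 * ip q (V q) (N1 q)), (fun q => (E q)^-1 * ip q (V q) (N2 q)).
split=> [r|r|q Uq].
- exact: (class_CM openU (smooth_invE r) (smooth_ip sV (fs_smooth1 fs) r)).
- exact: (class_CM openU (smooth_invE r) (smooth_ip sV (fs_smooth2 fs) r)).
apply/eqP; rewrite -subr_eq0; apply/eqP; apply: (orthogonal_eq0 Uq) => [k||].
- by rewrite dotBl dotDl !dotZl VT// (fs_normal1 fs)// (fs_normal2 fs)// !mulr0 addr0 subrr.
- rewrite dotBl dotDl !dotZl (fs_norm1 fs)// [ip q (N2 q) _]ipC// (fs_orth fs)//.
  by rewrite mulr0 addr0 mulrAC mulVf// mul1r subrr.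
- rewrite dotBl dotDl !dotZl (fs_norm2 fs)// (fs_orth fs)//.
  by rewrite mulr0 add0r mulrAC mulVf// mul1r subrr.
Qed.

End framed_surface_theory.

(** * Polar coordinates and conformal metrics *)

Section polar.
Variable R : realType.

(** A point on the circle is determined by its abscissa up to the sign of its
    ordinate, hence the two signs of the arc cosine. *)
Lemma polar_coordinates (x z : R) : 0 < x ^+ 2 + z ^+ 2 ->
  exists r c, [/\ 0 < r, x = r * cos c & z = r * sin c].
Proof.
move=> s0; pose r := Num.sqrt (x ^+ 2 + z ^+ 2).
have r0 : 0 < r by rewrite sqrtr_gt0.
have rr : r ^+ 2 = x ^+ 2 + z ^+ 2 by rewrite sqr_sqrtr// ltW.
have xr : -1 <= x / r <= 1.
  rewrite -ler_norml normrM normfV (gtr0_norm r0) ler_pdivrMr// mul1r.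
  by rewrite -sqrtr_sqr ler_wsqrtr// lerDl sqr_ge0.
have cosr : r * cos (acos (x / r)) = x.
  by rewrite acosK ?in_itv//= mulrC divfK// gt_eqF.
have sinr : r * sin (acos (x / r)) = `|z|.
  have rE : r = Num.sqrt (r ^+ 2) by rewrite sqrtr_sqr gtr0_norm.
  rewrite sin_acos// {1}rE -sqrtrM ?sqr_ge0// -sqrtr_sqr; congr Num.sqrt.
  rewrite mulrBr mulr1 -exprMn [r * _]mulrC divfK ?gt_eqF// rr.
  by rewrite addrAC subrr add0r.
exists r; have [z0|z0] := leP 0 z.
  by exists (acos (x / r)); rewrite cosr sinr ger0_norm.
exists (- acos (x / r)); rewrite cosN sinN mulrN cosr sinr ltr0_norm// opprK.
by split.
Qed.

End polar.

Section quadrilinear_delta.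
Variables (R : realType) (n : nat).

Lemma quadrilinear_delta (L : 'I_n -> 'I_n -> 'I_n -> 'I_n -> R) a b c d :
  quadrilinear L (delta_mx 0 a) (delta_mx 0 b) (delta_mx 0 c) (delta_mx 0 d) = L a b c d.
Proof.
have pick (i : 'I_n) (f : 'I_n -> R) : (forall j, j != i -> f j = 0) -> \sum_j f j = f i.
  by move=> f0; rewrite (bigD1 i)//= big1 ?addr0.
have del (i j : 'I_n) : (delta_mx 0 i : 'rV[R]_n) 0 j = (j == i)%:R by rewrite mxE.
rewrite /quadrilinear (pick a) => [|i ia].
  rewrite (pick b) => [|i ib].
    rewrite (pick c) => [|i ic].
      by rewrite (pick d) => [|i id]; rewrite !del ?eqxx ?mulr1// (negbTE id) mulr0.
    by rewrite big1// => j _; rewrite [X in _ * X * _]del (negbTE ic) mulr0 mul0r.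
  rewrite big1// => j _; rewrite big1// => k _.
  by rewrite [X in _ * X * _ * _]del (negbTE ib) mulr0 !mul0r.
rewrite big1// => j _; rewrite big1// => k _; rewrite big1// => l _.
by rewrite [X in _ * X * _ * _ * _]del (negbTE ia) mulr0 !mul0r.
Qed.

End quadrilinear_delta.

Section conformal_metric.
Variables (R : realType) (U : set 'rV[R]_2) (lam : 'rV[R]_2 -> R).
Hypothesis openU : open U.
Hypothesis smoothlam : smooth U lam.

Definition conformal_metric (q : 'rV[R]_2) : 'M[R]_2 := (expR (2 * lam q))%:M.

Lemma smooth_conformal_factor : smooth U (fun q => expR (2 * lam q)).
Proof.
move=> r; apply: class_C_expR => //; apply: class_CM => //; exact: class_C_cst.
Qed.

Lemma smooth_conformal_metric : smooth U conformal_metric.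
Proof.
apply/smooth_mxP => // i j r.
have := class_CM openU (smooth_conformal_factor r) (class_C_cst openU r ((i == j)%:R : R)).
by apply: class_C_ext => // q _; rewrite mxE mulr_natr.
Qed.

Lemma conformal_metric_sym q : (conformal_metric q)^T = conformal_metric q.
Proof. exact: tr_scalar_mx. Qed.

Lemma dot_conformal_metric q v w :
  dot (conformal_metric q) v w = expR (2 * lam q) * \sum_i v 0 i * w 0 i.
Proof.
rewrite /dot /conformal_metric mul_mx_scalar -scalemxAl !mxE; congr (_ * _).
by apply: eq_bigr => i _; rewrite mxE.
Qed.

Lemma conformal_metric_pos q v : v != 0 -> 0 < dot (conformal_metric q) v v.
Proof.
move=> v0; rewrite dot_conformal_metric mulr_gt0 ?expR_gt0//.
have sq (i : 'I_2) : 0 <= v 0 i * v 0 i by rewrite -expr2 sqr_ge0.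
rewrite lt_def sumr_ge0 ?andbT//; apply: contraNneq v0 => /eqP.
rewrite psumr_eq0// => /allP h; apply/eqP/rowP => i; rewrite mxE.
by have := h i (mem_index_enum i); rewrite /= mulf_eq0 orbb => /eqP.
Qed.

(** Both coordinate vectors have squared length e^(2 lam) and they are orthogonal, so
    the sectional curvature is one coefficient of the lowered curvature tensor. *)
Lemma gauss_curvatureE q :
  gauss_curvature lam q =
  curvature_lower conformal_metric q uu vv vv uu / expR (2 * lam q) ^+ 2.
Proof.
have d k l : dot (conformal_metric q) (delta_mx 0 k) (delta_mx 0 l) =
    expR (2 * lam q) * (k == l)%:R.
  rewrite dot_conformal_metric; congr (_ * _).
  rewrite (bigD1 k)//= big1 => [|i ik]; first by rewrite !mxE !eqxx mul1r addr0.
  by rewrite mxE (negbTE ik) andbF mul0r.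
rewrite /gauss_curvature /sectional_curvature -/conformal_metric.
by rewrite dot_curvature quadrilinear_delta !d /= !mulr1 mulr0 expr0n /= subr0 expr2.
Qed.

Lemma conformal_christoffel a b c q : U q ->
  christoffel conformal_metric a b c q =
  (expR (2 * lam q))^-1 * christoffel1 conformal_metric a b c q.
Proof.
move=> Uq; rewrite -(@christoffel_lower _ _ conformal_metric U) //; last first.
- by move=> x v _; exact: conformal_metric_pos.
- by move=> x _; exact: conformal_metric_sym.
rewrite (bigD1 c)//= big1 => [|e ec]; last by rewrite !mxE (negbTE ec) mulr0.
by rewrite addr0 !mxE eqxx mulr1n mulrCA mulVf ?mulr1// gt_eqF// expR_gt0.
Qed.

End conformal_metric.

(** * Unit normal fields and parallelism *)

Section normal_directions.
Variables (R : realType) (G : 'rV[R]_4 -> 'M[R]_4) (O : set 'rV[R]_4).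
Variables (U : set 'rV[R]_2) (y : 'rV[R]_2 -> 'rV[R]_4) (lam : 'rV[R]_2 -> R).
Variables (N1 N2 : 'rV[R]_2 -> 'rV[R]_4) (al be : 'I_2 -> 'I_2 -> 'rV[R]_2 -> R).
Variable mu : 'I_2 -> 'rV[R]_2 -> R.
Hypothesis fs : framed_surface G O U y lam N1 N2 al be mu.
Implicit Types (p q : 'rV[R]_2) (k l : 'I_2) (v w : 'rV[R]_4) (th : 'rV[R]_2 -> R).

Local Notation openO := (fs_openO fs).
Local Notation smoothG := (fs_metric_smooth fs).
Local Notation symG := (fs_metric_sym fs).
Local Notation posG := (fs_metric_pos fs).
Local Notation openU := (fs_openU fs).
Local Notation smoothy := (fs_map_smooth fs).
Local Notation yO := (fs_mapO fs).
Local Notation ip p := (dot (G (y p))).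
Local Notation T k p := (partial k y p).
Local Notation E p := (expR (2 * lam p)).

(** Every unit normal field is locally of this form, for an angle th. *)
Definition unit_normal th : 'rV[R]_2 -> 'rV[R]_4 :=
  normal_combination N1 N2 (fun q => expR (- lam q) * cos (th q))
    (fun q => expR (- lam q) * sin (th q)).

(** The second fundamental form has no component along [unit_normal th]. *)
Definition degenerate_direction th p :=
  forall k l, cos (th p) * al k l p + sin (th p) * be k l p = 0.

Let dlam p : U p -> differentiable lam p := smooth_diff (fs_lam_smooth fs).
Let E_neq0 p : E p != 0. Proof. by rewrite gt_eqF// expR_gt0. Qed.

Let diff_expNlam p : U p -> differentiable (fun q => expR (- lam q)) p.
Proof.
move=> Up; apply: differentiable_comp1; last exact: differentiableNf (dlam Up).
by have [] := is_derive_expR (- lam p).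
Qed.

Let diff_cos th p : differentiable th p -> differentiable (fun q => cos (th q)) p.
Proof. by move=> dth; apply: differentiable_comp1 dth; have [] := is_derive_cos (th p). Qed.

Let diff_sin th p : differentiable th p -> differentiable (fun q => sin (th q)) p.
Proof. by move=> dth; apply: differentiable_comp1 dth; have [] := is_derive_sin (th p). Qed.

Let partial_expNlam k p : U p ->
  partial k (fun q => expR (- lam q)) p = - (expR (- lam p) * partial k lam p).
Proof.
move=> Up; apply: etrans (partial_comp1 k (is_derive_expR _) (differentiableNf (dlam Up))) _.
by rewrite (partialN k (dlam Up)) mulrN.
Qed.

Let partial_cos th k p : differentiable th p ->
  partial k (fun q => cos (th q)) p = - (sin (th p) * partial k th p).
Proof. by move=> dth; rewrite (partial_comp1 k (is_derive_cos _) dth) mulNr. Qed.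

Let partial_sin th k p : differentiable th p ->
  partial k (fun q => sin (th q)) p = cos (th p) * partial k th p.
Proof. by move=> dth; rewrite (partial_comp1 k (is_derive_sin _) dth). Qed.

Section at_a_point.
Variables (th : 'rV[R]_2 -> R) (p : 'rV[R]_2).
Hypothesis Up : U p.
Hypothesis dth : differentiable th p.

Let dcos := differentiableMf (diff_expNlam Up) (diff_cos dth).
Let dsin := differentiableMf (diff_expNlam Up) (diff_sin dth).

Lemma cov_unit_normal_tangent k l : ip p (cov G y k (unit_normal th) p) (T l p) =
  - (E p * expR (- lam p) * (cos (th p) * al k l p + sin (th p) * be k l p)).
Proof.
rewrite (cov_normal_tangent fs Up dcos dsin); congr (- _).
by move: (E p) => e; ring.
Qed.

Lemma cov_unit_normal1 k : ip p (cov G y k (unit_normal th) p) (N1 p) =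
  - (E p * expR (- lam p) * sin (th p)) * (partial k th p + mu k p).
Proof.
apply: etrans (cov_normal1 fs Up dcos dsin k) _.
have -> : partial k (fun q => expR (- lam q) * cos (th q)) p =
    - (expR (- lam p) * partial k lam p) * cos (th p)
    + expR (- lam p) * - (sin (th p) * partial k th p).
  apply: etrans (partialM k (diff_expNlam Up) (diff_cos dth)) _.
  by rewrite (partial_expNlam k Up) (partial_cos k dth).
move: (E p) (expR (- lam p)) (partial k lam p) (partial k th p) => x1 x2 x3 x4; ring.
Qed.

Lemma cov_unit_normal2 k : ip p (cov G y k (unit_normal th) p) (N2 p) =
  E p * expR (- lam p) * cos (th p) * (partial k th p + mu k p).
Proof.
apply: etrans (cov_normal2 fs Up dcos dsin k) _.
have -> : partial k (fun q => expR (- lam q) * sin (th q)) p =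
    - (expR (- lam p) * partial k lam p) * sin (th p)
    + expR (- lam p) * (cos (th p) * partial k th p).
  apply: etrans (partialM k (diff_expNlam Up) (diff_sin dth)) _.
  by rewrite (partial_expNlam k Up) (partial_sin k dth).
move: (E p) (expR (- lam p)) (partial k lam p) (partial k th p) => x1 x2 x3 x4; ring.
Qed.

End at_a_point.

Lemma unit_normal_tangent th p k : U p -> ip p (unit_normal th p) (T k p) = 0.
Proof.
by move=> Up; rewrite dotDl !dotZl (fs_normal1 fs)// (fs_normal2 fs)// !mulr0 addr0.
Qed.

Lemma ip_unit_normal1 th p : U p ->
  ip p (unit_normal th p) (N1 p) = E p * expR (- lam p) * cos (th p).
Proof.
move=> Up; rewrite dotDl !dotZl (fs_norm1 fs)// (ipC fs (N2 p) _ Up) (fs_orth fs)//.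
by move: (E p) => e; ring.
Qed.

Lemma ip_unit_normal2 th p : U p ->
  ip p (unit_normal th p) (N2 p) = E p * expR (- lam p) * sin (th p).
Proof.
move=> Up; rewrite dotDl !dotZl (fs_norm2 fs)// (fs_orth fs)//.
by move: (E p) => e; ring.
Qed.

Lemma unit_normal_norm th p : U p -> ip p (unit_normal th p) (unit_normal th p) = 1.
Proof.
move=> Up; rewrite (parseval fs)// !unit_normal_tangent// ip_unit_normal1// ip_unit_normal2//.
have -> : expR (- lam p) = (expR (lam p))^-1 by rewrite expRN.
have -> : E p = expR (lam p) ^+ 2 by rewrite mulr_natl mulr2n expRD.
have := cos2Dsin2 (th p); have : expR (lam p) != 0 by rewrite gt_eqF// expR_gt0.
move: (expR (lam p)) (cos (th p)) (sin (th p)) => e c s e0 cs.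
have -> : (e ^+ 2)^-1 * (0 * 0 + 0 * 0 + e ^+ 2 / e * c * (e ^+ 2 / e * c) +
   e ^+ 2 / e * s * (e ^+ 2 / e * s)) = c ^+ 2 + s ^+ 2 by field.
exact: cs.
Qed.

Lemma unit_normal_neq0 th p : U p -> unit_normal th p != 0.
Proof.
move=> Up; apply/eqP => n0; have := unit_normal_norm th Up.
by rewrite n0 /dot !mul0mx mxE => /esym/eqP; rewrite oner_eq0.
Qed.

Lemma smooth_unit_normal th : smooth U th -> smooth U (unit_normal th).
Proof.
move=> sth r; have oU := openU.
have ce : class_C r U (fun q => expR (- lam q)).
  by apply: class_C_expR => //; apply: class_CN => //; exact: (fs_lam_smooth fs).
apply: class_CD => //; apply: class_CZ => //.
- by apply: class_CM => //; exact: class_C_cos.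
- exact: (fs_smooth1 fs).
- by apply: class_CM => //; exact: class_C_sin.
- exact: (fs_smooth2 fs).
Qed.

(** A degenerate unit normal is orthogonal to the second fundamental form, so its
    derivative has no tangential part; being of constant length, it can only
    rotate towards the other unit normal direction, th + pi/2. The speed of this
    rotation is that of th, corrected by the normal connection. *)
Lemma cov_degenerate th p k : U p -> differentiable th p -> degenerate_direction th p ->
  cov G y k (unit_normal th) p =
  (partial k th p + mu k p) *: unit_normal (fun q => th q + pi / 2) p.
Proof.
move=> Up dth dep; apply/eqP; rewrite -subr_eq0; apply/eqP.
apply: (orthogonal_eq0 fs Up) => [l||]; rewrite dotBl dotZl.
- by rewrite cov_unit_normal_tangent// dep unit_normal_tangent// !mulr0 !oppr0 addr0.
- rewrite cov_unit_normal1// ip_unit_normal1// cosDpihalf.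
  by move: (E p) (partial k th p) => x1 x2; ring.
- rewrite cov_unit_normal2// ip_unit_normal2// sinDpihalf.
  by move: (E p) (partial k th p) => x1 x2; ring.
Qed.

Lemma unit_normal_parallel th p k : U p -> differentiable th p ->
  degenerate_direction th p -> partial k th p + mu k p = 0 ->
  cov G y k (unit_normal th) p = 0.
Proof. by move=> Up dth dep w0; rewrite cov_degenerate// w0 scale0r. Qed.

(** Let a, b be the components of xi in the frame N1, N2. Parallelism says that the
    pair e^lam (a, b) satisfies the linear system of a rotation of speed - mu;
    turned by the angle gam it is constant, equal to r (cos c, sin c). The angle
    of xi is therefore c - gam, and no continuous choice of an argument is
    needed. That xi has no tangential derivative gives the degeneracy. *)
Lemma parallel_normal_unit (xi : 'rV[R]_2 -> 'rV[R]_4) (gam : 'rV[R]_2 -> R) :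
  connected U -> U !=set0 -> smooth U xi ->
  (forall q k, U q -> ip q (xi q) (T k q) = 0) ->
  (forall q, U q -> xi q != 0) ->
  (forall q k, U q -> cov G y k xi q = 0) ->
  smooth U gam -> (forall q k, U q -> partial k gam q = mu k q) ->
  exists c r : R, 0 < r /\ forall q, U q ->
    xi q = r *: unit_normal (fun q => c - gam q) q /\
    degenerate_direction (fun q => c - gam q) q.
Proof.
move=> cU [p0 Up0] sxi xiT xi0 xip sgam gamk.
have [a [b [sa sb xiE]]] := normal_fieldE fs sxi xiT.
have da q : U q -> differentiable a q := smooth_diff sa.
have db q : U q -> differentiable b q := smooth_diff sb.
have dgam q : U q -> differentiable gam q := smooth_diff sgam.
have cov0 q k : U q -> cov G y k (normal_combination N1 N2 a b) q = 0.
  move=> Uq; rewrite -(xip q k Uq); apply/esym/cov_near.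
  by apply: (open_near_eq openU) Uq => z Uz; exact: xiE.
have e1 q k : U q -> partial k a q + a q * partial k lam q - b q * mu k q = 0.
  move=> Uq; have := cov_normal1 fs Uq (da q Uq) (db q Uq) k.
  rewrite cov0// /dot !mul0mx mxE => /esym/eqP; rewrite mulf_eq0 (negbTE (E_neq0 q)).
  by move=> /eqP.
have e2 q k : U q -> partial k b q + b q * partial k lam q + a q * mu k q = 0.
  move=> Uq; have := cov_normal2 fs Uq (da q Uq) (db q Uq) k.
  rewrite cov0// /dot !mul0mx mxE => /esym/eqP; rewrite mulf_eq0 (negbTE (E_neq0 q)).
  by move=> /eqP.
have e3 q k l : U q -> a q * al k l q + b q * be k l q = 0.
  move=> Uq; have := cov_normal_tangent fs Uq (da q Uq) (db q Uq) k l.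
  rewrite cov0// /dot !mul0mx mxE => /esym/eqP; rewrite oppr_eq0 mulf_eq0 (negbTE (E_neq0 q)).
  by move=> /eqP.
have dexp q : U q -> differentiable (fun q => expR (lam q)) q.
  by move=> Uq; apply: differentiable_comp1 (dlam Uq); have [] := is_derive_expR (lam q).
have pexp q k : U q -> partial k (fun q => expR (lam q)) q = expR (lam q) * partial k lam q.
  by move=> Uq; exact: (partial_comp1 k (is_derive_expR _) (dlam Uq)).
(* The frame turned by the angle - gam is parallel for the normal connection,
   so the components P and Q in this frame are constant. *)
pose P q := expR (lam q) * (a q * cos (gam q) - b q * sin (gam q)).
pose Q q := expR (lam q) * (a q * sin (gam q) + b q * cos (gam q)).
have dac q (Uq : U q) := differentiableMf (da q Uq) (diff_cos (dgam q Uq)).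
have das q (Uq : U q) := differentiableMf (da q Uq) (diff_sin (dgam q Uq)).
have dbc q (Uq : U q) := differentiableMf (db q Uq) (diff_cos (dgam q Uq)).
have dbs q (Uq : U q) := differentiableMf (db q Uq) (diff_sin (dgam q Uq)).
have dP1 q (Uq : U q) := differentiableDf (dac q Uq) (differentiableNf (dbs q Uq)).
have dQ1 q (Uq : U q) := differentiableDf (das q Uq) (dbc q Uq).
have dP q (Uq : U q) : differentiable P q := differentiableMf (dexp q Uq) (dP1 q Uq).
have dQ q (Uq : U q) : differentiable Q q := differentiableMf (dexp q Uq) (dQ1 q Uq).
have pP q k : U q -> partial k P q = 0.
  move=> Uq; apply: etrans (partialM k (dexp q Uq) (dP1 q Uq)) _.
  rewrite (pexp q k Uq) (partialD k (dac q Uq) (differentiableNf (dbs q Uq))).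
  rewrite (partialN k (dbs q Uq)) (partialM k (da q Uq) (diff_cos (dgam q Uq))).
  rewrite (partialM k (db q Uq) (diff_sin (dgam q Uq))).
  rewrite (partial_cos k (dgam q Uq)) (partial_sin k (dgam q Uq)) (gamk q k Uq).
  move: (e1 q k Uq) (e2 q k Uq).
  move: (partial k lam q) (partial k a q) (partial k b q) (expR (lam q)) => l1 a1 b1 e h1 h2.
  rewrite [LHS](_ : _ = e * (cos (gam q) * (a1 + a q * l1 - b q * mu k q)
     - sin (gam q) * (b1 + b q * l1 + a q * mu k q))); last by ring.
  by rewrite h1 h2 !mulr0 subrr mulr0.
have pQ q k : U q -> partial k Q q = 0.
  move=> Uq; apply: etrans (partialM k (dexp q Uq) (dQ1 q Uq)) _.
  rewrite (pexp q k Uq) (partialD k (das q Uq) (dbc q Uq)).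
  rewrite (partialM k (da q Uq) (diff_sin (dgam q Uq))).
  rewrite (partialM k (db q Uq) (diff_cos (dgam q Uq))).
  rewrite (partial_cos k (dgam q Uq)) (partial_sin k (dgam q Uq)) (gamk q k Uq).
  move: (e1 q k Uq) (e2 q k Uq).
  move: (partial k lam q) (partial k a q) (partial k b q) (expR (lam q)) => l1 a1 b1 e h1 h2.
  rewrite [LHS](_ : _ = e * (sin (gam q) * (a1 + a q * l1 - b q * mu k q)
     + cos (gam q) * (b1 + b q * l1 + a q * mu k q))); last by ring.
  by rewrite h1 h2 !mulr0 addr0 mulr0.
have cP q (Uq : U q) := constant_of_partial0 openU cU dP pP Uq Up0.
have cQ q (Uq : U q) := constant_of_partial0 openU cU dQ pQ Uq Up0.
have [|r [c [r0 Pc Qs]]] := @polar_coordinates _ (P p0) (Q p0).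
  rewrite lt_def addr_ge0 ?sqr_ge0// andbT; apply/negP => /eqP s0.
  have /negP[] := xi0 p0 Up0; rewrite xiE// /normal_combination.
  have cs := cos2Dsin2 (gam p0).
  have : expR (lam p0) ^+ 2 * (a p0 ^+ 2 + b p0 ^+ 2) = 0.
    rewrite -s0 /P /Q -[_ + b p0 ^+ 2]mulr1 -cs.
    by move: (expR (lam p0)) (cos (gam p0)) (sin (gam p0)) => x1 x2 x3; ring.
  move=> /eqP; rewrite mulf_eq0 expf_eq0 /= (gt_eqF (expR_gt0 _)) /=.
  rewrite paddr_eq0 ?sqr_ge0// !expf_eq0 /= => /andP[/eqP -> /eqP ->].
  by rewrite !scale0r addr0.
exists c, r; split=> // q Uq.
have aE : expR (lam q) * a q = r * cos (c - gam q).
  have cs := cos2Dsin2 (gam q).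
  have : expR (lam q) * a q = P q * cos (gam q) + Q q * sin (gam q).
    rewrite /P /Q -[LHS]mulr1 -cs.
    by move: (expR (lam q)) (cos (gam q)) (sin (gam q)) => x1 x2 x3; ring.
  rewrite (cP q Uq) (cQ q Uq) Pc Qs cosB => ->.
  by move: (cos c) (sin c) (cos _) (sin _) => x1 x2 x3 x4; ring.
have bE : expR (lam q) * b q = r * sin (c - gam q).
  have cs := cos2Dsin2 (gam q).
  have : expR (lam q) * b q = Q q * cos (gam q) - P q * sin (gam q).
    rewrite /P /Q -[LHS]mulr1 -cs.
    by move: (expR (lam q)) (cos (gam q)) (sin (gam q)) => x1 x2 x3; ring.
  rewrite (cP q Uq) (cQ q Uq) Pc Qs sinB => ->.
  by move: (cos c) (sin c) (cos _) (sin _) => x1 x2 x3 x4; ring.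
split.
  rewrite xiE// /unit_normal /normal_combination scalerDr !scalerA.
  by rewrite !(mulrCA r) -aE -bE !mulrA -expRD addNr expR0 !mul1r.
move=> k l; apply: (mulfI (lt0r_neq0 r0)); rewrite mulr0 mulrDr !mulrA -aE -bE.
by rewrite -!mulrA -mulrDr e3// mulr0.
Qed.

End normal_directions.

(** * The equations of Gauss and Codazzi *)

Lemma sum_uv (R : realType) (f : 'I_2 -> R) : \sum_i f i = f uu + f vv.
Proof.
by rewrite !big_ord_recl big_ord0 addr0; congr (f _ + f _); apply/val_inj.
Qed.

Section gauss_codazzi.
Variables (R : realType) (G : 'rV[R]_4 -> 'M[R]_4) (O : set 'rV[R]_4).
Variables (U : set 'rV[R]_2) (y : 'rV[R]_2 -> 'rV[R]_4) (lam : 'rV[R]_2 -> R).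
Variables (N1 N2 : 'rV[R]_2 -> 'rV[R]_4) (al be : 'I_2 -> 'I_2 -> 'rV[R]_2 -> R).
Variable mu : 'I_2 -> 'rV[R]_2 -> R.
Hypothesis fs : framed_surface G O U y lam N1 N2 al be mu.
Variable L0 : R.
Hypothesis constG : forall x (X Y : 'rV[R]_4), O x -> row_free (col_mx X Y) ->
  sectional_curvature G x X Y = L0.
Implicit Types (p q : 'rV[R]_2) (k l : 'I_2) (v w : 'rV[R]_4) (th : 'rV[R]_2 -> R).

Local Notation openO := (fs_openO fs).
Local Notation smoothG := (fs_metric_smooth fs).
Local Notation symG := (fs_metric_sym fs).
Local Notation posG := (fs_metric_pos fs).
Local Notation openU := (fs_openU fs).
Local Notation smoothy := (fs_map_smooth fs).
Local Notation yO := (fs_mapO fs).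
Local Notation ip p := (dot (G (y p))).
Local Notation T k p := (partial k y p).
Local Notation E p := (expR (2 * lam p)).
Local Notation g := (conformal_metric lam).
Local Notation nor := (unit_normal lam N1 N2).

Let E_neq0 p : E p != 0. Proof. by rewrite gt_eqF// expR_gt0. Qed.
Let e_neq0 p : expR (- lam p) != 0. Proof. by rewrite gt_eqF// expR_gt0. Qed.
Let sT k : smooth U (partial k y) := smooth_partial k smoothy.
Let dT k p : U p -> differentiable (partial k y) p := smooth_diff (sT k).
Let scov k (V : 'rV[R]_2 -> 'rV[R]_4) : smooth U V -> smooth U (cov G y k V).
Proof. exact: (smooth_cov openO smoothG posG openU smoothy yO). Qed.

Let T_neq0 k p : U p -> T k p != 0.
Proof.
move=> Up; apply/eqP => T0; have := fs_tangent fs k k Up.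
rewrite T0 /dot !mul0mx mxE eqxx mulr1n => /esym/eqP.
by rewrite (negbTE (E_neq0 p)).
Qed.

Let T_orth k l p : U p -> k != l -> ip p (T k p) (T l p) = 0.
Proof. by move=> Up kl; rewrite (fs_tangent fs)// (negbTE kl). Qed.

Let dotd k (V W : 'rV[R]_2 -> 'rV[R]_4) p : U p -> differentiable V p -> differentiable W p ->
  partial k (fun q => ip q (V q) (W q)) p = ip p (cov G y k V p) (W p) + ip p (V p) (cov G y k W p).
Proof. by move=> Up dV dW; exact: (partial_dot openO smoothG symG posG smoothy yO). Qed.

(** Koszul's formula: the tangential part of the ambient connection is metric and
    torsion free, so that it is determined by the induced metric. *)
Lemma cov_tangent_tangent k l m p : U p ->
  ip p (cov G y k (partial l y) p) (T m p) = christoffel1 g k l m p.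
Proof.
move=> Up.
have compat a b c : ip p (cov G y a (partial b y) p) (T c p)
    + ip p (cov G y a (partial c y) p) (T b p) = partial a (fun q => (g q b c : R)) p.
  transitivity (partial a (fun q => ip q (T b q) (T c q)) p).
    by rewrite (dotd a Up (dT b Up) (dT c Up)) [X in _ = _ + X](ipC fs _ _ Up).
  apply: partial_near; apply: (open_near_eq openU) Up => q Uq.
  by rewrite (fs_tangent fs)// mxE.
have C a b : cov G y a (partial b y) p = cov G y b (partial a y) p.
  exact: (cov_tangentC openO symG openU smoothy yO).
rewrite /christoffel1 -(compat k l m) -(compat l k m) -(compat m k l).
rewrite (C l k) (C m k) (C m l).
by generalize (ip p (cov G y k (partial l y) p) (T m p)) (ip p (cov G y k (partial m y) p) (T l p))
  (ip p (cov G y l (partial m y) p) (T k p)); intros; lra.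
Qed.

Let conformal_product k l m n p : U p -> christoffel_product g k l m n p =
  (E p)^-1 * (christoffel1 g k l uu p * christoffel1 g m n uu p
              + christoffel1 g k l vv p * christoffel1 g m n vv p).
Proof.
move=> Up.
transitivity (\sum_e (E p)^-1 * (christoffel1 g k l e p * christoffel1 g m n e p)).
  apply: eq_bigr => e _.
  apply: etrans (congr1 (fun t => t * _) (conformal_christoffel lam k l e Up)) _.
  exact: (esym (mulrA _ _ _)).
rewrite -mulr_sumr; apply: (congr1 (fun t => (E p)^-1 * t)).
exact: (sum_uv (fun e => christoffel1 g k l e p * christoffel1 g m n e p)).
Qed.

Let ip_cov_tangent k l m n p : U p ->
  ip p (cov G y k (partial l y) p) (cov G y m (partial n y) p) =
  christoffel_product g k l m n p
  + E p * (al k l p * al m n p + be k l p * be m n p).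
Proof.
move=> Up; apply: etrans (parseval fs _ _ Up) _.
have H a b c := cov_tangent_tangent a b c Up.
have key (e x1 x2 x3 x4 x5 x6 x7 x8 c1 c2 c3 c4 a1 a2 b1 b2 : R) : e != 0 ->
  x1 = c1 -> x2 = c2 -> x3 = c3 -> x4 = c4 ->
  x5 = e * a1 -> x6 = e * a2 -> x7 = e * b1 -> x8 = e * b2 ->
  e^-1 * (x1 * x2 + x3 * x4 + x5 * x6 + x7 * x8) =
  e^-1 * (c1 * c2 + c3 * c4) + e * (a1 * a2 + b1 * b2).
  by move=> e0 -> -> -> -> -> -> -> ->; field.
apply: etrans (key _ _ _ _ _ _ _ _ _ _ _ _ _ _ _ _ _ (E_neq0 p)
  (H k l uu) (H m n uu) (H k l vv) (H m n vv)
  (fs_al fs k l Up) (fs_al fs m n Up) (fs_be fs k l Up) (fs_be fs m n Up)) _.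
by congr (_ + _); apply: esym; exact: conformal_product.
Qed.

(** The tangential part of the ambient second derivatives is the connection of the
    induced metric, and the normal part contributes the determinant of the second
    fundamental form: the quadratic terms of the two curvature tensors are compared
    with the help of [parseval]. *)
Lemma gauss_equation p : U p ->
  quadrilinear (curvature_lower G (y p)) (T uu p) (T vv p) (T vv p) (T uu p) =
  curvature_lower g p uu vv vv uu
  - E p * (al vv vv p * al uu uu p + be vv vv p * be uu uu p
           - (al uu vv p * al vv uu p + be uu vv p * be vv uu p)).
Proof.
move=> Up; rewrite -dot_curvature.
have <- := cov_commutator openO smoothG posG openU smoothy yO uu vv Up (sT vv).
have step a b : ip p (cov G y a (cov G y b (partial vv y)) p) (T uu p) =
    partial a (christoffel1 g b vv uu) p
    - ip p (cov G y b (partial vv y) p) (cov G y a (partial uu y) p).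
  have dc := smooth_diff (scov b (sT vv)) Up.
  have := dotd a Up dc (dT uu Up).
  rewrite (_ : partial a _ p = partial a (christoffel1 g b vv uu) p); last first.
    apply: partial_near; apply: (open_near_eq openU) Up => q Uq.
    exact: cov_tangent_tangent.
  by move=> ->; rewrite addrK.
rewrite dotBl.
have I k l m n := ip_cov_tangent k l m n Up.
apply: etrans (congr2 (fun s t => s - t) (step uu vv) (step vv uu)) _.
apply: etrans (congr2 (fun s t => s - t) (congr1 (fun t => _ - t) (I vv vv uu uu))
  (congr1 (fun t => _ - t) (I uu vv vv uu))) _.
have := @curvature_lowerE _ _ g U openU (smooth_conformal_metric openU (fs_lam_smooth fs))
  (fun (x : 'rV[R]_2) _ => conformal_metric_sym lam x) (fun x (z : 'rV[R]_2) _ => @conformal_metric_pos _ lam x z)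
  uu vv vv uu p Up.
move=> ->.
have regroup (P1 P2 Q1 Q2 e x1 x2 : R) :
  P1 - (Q1 + e * x1) - (P2 - (Q2 + e * x2)) = P1 - Q1 - (P2 - Q2) - e * (x1 - x2) by ring.
exact: regroup.
Qed.

Lemma gauss_curvature_flat p : U p ->
  al vv vv p * al uu uu p + be vv vv p * be uu uu p
    = al uu vv p * al vv uu p + be uu vv p * be vv uu p ->
  gauss_curvature lam p = L0.
Proof.
move=> Up det0; have uv : uu != vv by [].
have := gauss_equation Up; rewrite det0 subrr mulr0 subr0.
rewrite (curvature_orthogonal symG posG constG (yO Up) (T_orth Up uv) (T_neq0 uu Up) (T_neq0 vv Up)).
rewrite !(fs_tangent fs)// !eqxx !mulr1n => Eq.
by rewrite gauss_curvatureE -Eq expr2 -[L0 * _ * _]mulrA mulfK// mulf_neq0.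
Qed.

(** The second fundamental form has values in the line of the other unit normal
    eta, with coefficients proportional to tau, and the derivative of the
    degenerate unit normal is w eta. Computing the curvature R(T_1, T_2) on this
    unit normal gives w_2 (nabla_1 eta) - w_1 (nabla_2 eta) up to a multiple of
    eta; its tangential part vanishes in constant curvature. *)
Lemma codazzi_degenerate th p l : smooth U th ->
  (forall q, U q -> degenerate_direction al be th q) -> U p ->
  let w k := partial k th p + mu k p in
  let tau k l := - sin (th p) * al k l p + cos (th p) * be k l p in
  w vv * tau uu l = w uu * tau vv l.
Proof.
move=> sth dep Up w tau.
pose eta := nor (fun q => th q + pi / 2).
have sth' : smooth U (fun q => th q + pi / 2).
  by move=> r; apply: class_CD; [exact: openU|exact: sth|apply: class_C_cst; exact: openU].
have seta : smooth U eta := smooth_unit_normal fs sth'.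
have sxi : smooth U (nor th) := smooth_unit_normal fs sth.
have etaT k q : U q -> ip q (eta q) (T k q) = 0 by move=> Uq; exact: (unit_normal_tangent fs).
have second a b : ip p (cov G y a (cov G y b (nor th)) p) (T l p) =
    - (E p * expR (- lam p)) * (w b * tau a l).
  have dw : differentiable (fun q => partial b th q + mu b q) p.
    apply: differentiableDf; first exact: smooth_diff (smooth_partial b sth) Up.
    exact: smooth_diff (smooth_mu fs b) Up.
  have near_w : {near p, cov G y b (nor th) =1
      (fun q => (partial b th q + mu b q) *: eta q)}.
    apply: (open_near_eq openU) Up => q Uq.
    by apply: (cov_degenerate fs b Uq); [exact: smooth_diff sth Uq|exact: dep].
  rewrite (cov_near G y a near_w) (covZ _ _ _ dw (smooth_diff seta Up)).
  rewrite dotDl !dotZl etaT// mulr0 add0r.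
  rewrite (cov_unit_normal_tangent fs Up (smooth_diff sth' Up)) cosDpihalf sinDpihalf.
  rewrite -/(w b) -/(tau a l).
  by move: (w b) (tau a l) (E p) => x1 x2 x3; ring.
have uv : uu != vv by [].
have vu : vv != uu by [].
have XZ k : ip p (T k p) (nor th p) = 0 by rewrite (ipC fs)// (unit_normal_tangent fs).
have ZX k : ip p (nor th p) (T k p) = 0 by exact: (unit_normal_tangent fs).
have n0 := unit_normal_neq0 fs th Up.
have Q0 : quadrilinear (curvature_lower G (y p)) (T uu p) (T vv p) (nor th p) (T l p) = 0.
  have mixed k m : k != m -> quadrilinear (curvature_lower G (y p)) (T k p) (T m p) (nor th p) (T m p) = 0.
    move=> km; apply: (curvature_mixed' openO smoothG symG posG constG (yO Up)) => //.
    - exact: T_orth.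
    - exact: T_neq0.
    - exact: T_neq0.
  have [->|->] : l = vv \/ l = uu by case: (l) => -[|[|//]] ?; [right|left]; apply/val_inj.
    exact: mixed.
  rewrite (quadrilinear_skew _ _ _ _ (fun a b c d => curvature_lower_skew G (y p) a b c d)).
  by rewrite mixed// oppr0.
have := cov_commutator openO smoothG posG openU smoothy yO uu vv Up sxi.
move=> /(congr1 (fun v => ip p v (T l p))) C.
have := etrans (congr2 (fun s t => s - t) (esym (second uu vv)) (esym (second vv uu)))
  (etrans (esym (dotBl _ _ _ _)) (etrans C (etrans (dot_curvature _ _ _ _ _ _) Q0))).
move=> /eqP; rewrite -mulrBr mulf_eq0 oppr_eq0 mulf_eq0 (negbTE (E_neq0 p)) (negbTE (e_neq0 p)) /=.
by rewrite subr_eq0 => /eqP.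
Qed.

(** If w = d th + mu does not vanish at p, the Codazzi equation makes the rows of tau
    proportional. The second fundamental form, which is proportional to tau, then
    has determinant zero, and the Gauss equation gives K = L0 at p. *)
Lemma degenerate_angle th p k : smooth U th ->
  (forall q, U q -> degenerate_direction al be th q) -> U p ->
  gauss_curvature lam p <> L0 -> partial k th p + mu k p = 0.
Proof.
move=> sth dep Up KL0; apply: contrapT => /eqP wk.
apply: KL0; apply: gauss_curvature_flat => //.
have C l := codazzi_degenerate l sth dep Up; move: C => /=.
have dp := dep p Up; have cs := cos2Dsin2 (th p); move: dp cs.
rewrite /degenerate_direction; move: (cos (th p)) (sin (th p)) => c s dp cs C.
pose tau i j := - s * al i j p + c * be i j p.
have alE i j : al i j p = - s * tau i j.
  rewrite /tau -[LHS]mul1r -cs; have := dp i j; move: (al i j p) (be i j p) => a b h.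
  have -> : (c ^+ 2 + s ^+ 2) * a = c * (c * a + s * b) - s * (- s * a + c * b) by ring.
  by rewrite h mulr0 add0r [RHS]mulNr.
have beE i j : be i j p = c * tau i j.
  rewrite /tau -[LHS]mul1r -cs; have := dp i j; move: (al i j p) (be i j p) => a b h.
  have -> : (c ^+ 2 + s ^+ 2) * b = s * (c * a + s * b) + c * (- s * a + c * b) by ring.
  by rewrite h mulr0 add0r.
rewrite !alE !beE.
have Cl l : (partial vv th p + mu vv p) * tau uu l = (partial uu th p + mu uu p) * tau vv l.
  exact: C.
have [Cu Cv] := (Cl uu, Cl vv).
suff det0 : tau vv vv * tau uu uu - tau uu vv * tau vv uu = 0.
  rewrite [LHS](_ : _ = (c ^+ 2 + s ^+ 2) * (tau vv vv * tau uu uu)); last by ring.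
  rewrite [RHS](_ : _ = (c ^+ 2 + s ^+ 2) * (tau uu vv * tau vv uu)); last by ring.
  by congr (_ * _); apply/eqP; rewrite -subr_eq0 det0.
move: (tau uu uu) (tau uu vv) (tau vv uu) (tau vv vv) Cu Cv => t1 t2 t3 t4.
have kE : k = vv \/ k = uu by case: (k) => -[|[|//]] ?; [right|left]; apply/val_inj.
case: kE wk => ->; move: (partial uu th p + mu uu p) (partial vv th p + mu vv p) => wu wv w0 Cu Cv.
  apply: (mulfI w0); rewrite mulr0 mulrBr [wv * (t4 * _)]mulrCA Cu [wv * (t2 * _)]mulrA Cv.
  by ring.
apply: (mulfI w0); rewrite mulr0 mulrBr mulrA -Cv [wu * (t2 * _)]mulrCA -Cu.
by ring.
Qed.

End gauss_codazzi.

(** * From charts to the manifold *)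

(** The three coefficients of a symmetric bilinear form, indexed by pairs of
    coordinates so that one statement covers all of them. *)
Definition symmetric_array (A : Type) (a1 a2 a3 : A) (k l : 'I_2) : A :=
  if k == l then (if k == uu then a1 else a3) else a2.

Definition uv_pair (A : Type) (a1 a2 : A) (k : 'I_2) : A := if k == uu then a1 else a2.

Lemma uv_case (P : 'I_2 -> Prop) : P uu -> P vv -> forall k, P k.
Proof.
move=> Pu Pv; case=> -[|[|//]] k2.
  by rewrite (_ : Ordinal k2 = uu)//; apply/val_inj.
by rewrite (_ : Ordinal k2 = vv)//; apply/val_inj.
Qed.

Section charts.
Variables (R : realType) (N : manifold R 4) (h : riemannian_metric N).
Variables (D : set 'rV[R]_2) (F : 'rV[R]_2 -> N) (lam : 'rV[R]_2 -> R).
Hypothesis openD : open D.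
Hypothesis hF : conformal_immersion h F D lam.
Variables (N1 N2 : field N).
Hypothesis hN12 : normal_frame h F D lam N1 N2.
Variables (al1 al2 al3 be1 be2 be3 mu1 mu2 : 'rV[R]_2 -> R).
Hypothesis hsigma : second_fundamental_form h F D N1 N2 al1 al2 al3 be1 be2 be3.
Hypothesis hmu : normal_connection_form h F D lam N1 N2 mu1 mu2.
Implicit Types (i j : chart N) (p q : 'rV[R]_2).

Local Notation crd i := (@Defs.coord R 4 N i).
Local Notation al := (symmetric_array al1 al2 al3).
Local Notation be := (symmetric_array be1 be2 be3).
Local Notation mu := (uv_pair mu1 mu2).
Local Notation E p := (expR (2 * lam p)).

Lemma open_chart_preimage (V : set 'rV[R]_2) i : open V -> V `<=` D ->
  open (V `&` F @^-1` dom i).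
Proof.
move=> oV VD; rewrite openE => q [Vq Fq].
have [[cF _] _ _] := hF; apply: filterI; first exact: open_nbhs_nbhs.
by apply: (cF q (VD q Vq)); exact: (open_nbhs_nbhs (conj (dom_open i) Fq)).
Qed.

Let inner_tangent i q k l : D q -> dom i (F q) ->
  inner h F i q (tangent F k i q) (tangent F l i q) = E q *+ (k == l).
Proof. by move=> Dq Fq; have [_ _] := hF; apply. Qed.

(** The Gram matrix of the tangent frame is scalar. *)
Lemma normal_partE i q (V : field N) : D q -> dom i (F q) ->
  normal_part h F V i q = V i q -
    \sum_k ((E q)^-1 * inner h F i q (V i q) (tangent F k i q)) *: tangent F k i q.
Proof.
move=> Dq Fq; rewrite /normal_part; congr (_ - _); apply: eq_bigr => k _.
have -> : \matrix_(k, l) inner h F i q (tangent F k i q) (tangent F l i q) = (E q)%:M.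
  by apply/matrixP => a b; rewrite !mxE inner_tangent.
rewrite invmx_scalar (bigD1 k)//= big1 => [|l lk].
  by rewrite addr0 mxE eqxx mulr1n.
by rewrite mxE eq_sym (negbTE lk) mulr0n mul0r scale0r.
Qed.

Lemma inner_normal_part i q (V : field N) w : D q -> dom i (F q) ->
  (forall k, inner h F i q (tangent F k i q) w = 0) ->
  inner h F i q (normal_part h F V i q) w = inner h F i q (V i q) w.
Proof.
move=> Dq Fq Tw; rewrite normal_partE// /inner dotBl dot_suml big1 ?subr0// => k _.
by rewrite dotZl [dot _ _ w]Tw mulr0.
Qed.

(** The defining equations of the second fundamental form and of the normal
    connection are turned into inner products with N1 and N2, for which taking the
    normal part makes no difference. *)
Lemma chart_framed_surface i :
  framed_surface (h i) (crd i @` dom i) (D `&` F @^-1` dom i) (crd i \o F) lam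
    (N1 i) (N2 i) al be mu.
Proof.
have [[cF sF] slam _] := hF; have [[[sN1 _] nN1] [[sN2 _] nN2] nn] := hN12.
have sG x : (crd i @` dom i) x -> (h i x)^T = h i x.
  by move=> [z iz <-]; exact: Defs.metric_sym.
have oU : open (D `&` F @^-1` dom i) by exact: open_chart_preimage.
have n1 q k : (D `&` F @^-1` dom i) q -> inner h F i q (N1 i q) (tangent F k i q) = 0.
  by move=> [Dq Fq]; exact: nN1.
have n2 q k : (D `&` F @^-1` dom i) q -> inner h F i q (N2 i q) (tangent F k i q) = 0.
  by move=> [Dq Fq]; exact: nN2.
have yO q : (D `&` F @^-1` dom i) q -> (crd i @` dom i) ((crd i \o F) q).
  by move=> [Dq Fq]; exists (F q).
have n1' q k : (D `&` F @^-1` dom i) q -> inner h F i q (tangent F k i q) (N1 i q) = 0.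
  by move=> Uq; rewrite -(n1 q k Uq); apply/dotC/sG; exact: yO.
have n2' q k : (D `&` F @^-1` dom i) q -> inner h F i q (tangent F k i q) (N2 i q) = 0.
  by move=> Uq; rewrite -(n2 q k Uq); apply/dotC/sG; exact: yO.
have comb1 q a b : (D `&` F @^-1` dom i) q ->
    inner h F i q (a *: N1 i q + b *: N2 i q) (N1 i q) = E q * a.
  move=> Uq; have [Dq Fq] := Uq; have [e1 e2 e3] := nn i q Dq Fq.
  have e3' : inner h F i q (N2 i q) (N1 i q) = 0.
    by rewrite -e3; apply/dotC/sG; exact: yO.
  by move: e1 e2 e3 e3'; rewrite /inner dotDl !dotZl => -> _ _ ->; rewrite mulr0 addr0 mulrC.
have comb2 q a b : (D `&` F @^-1` dom i) q ->
    inner h F i q (a *: N1 i q + b *: N2 i q) (N2 i q) = E q * b.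
  move=> Uq; have [Dq Fq] := Uq; have [e1 e2 e3] := nn i q Dq Fq.
  by move: e1 e2 e3; rewrite /inner dotDl !dotZl => _ -> ->; rewrite mulr0 add0r mulrC.
have tanC q k l : (D `&` F @^-1` dom i) q ->
    cov (h i) (crd i \o F) k (partial l (crd i \o F)) q =
    cov (h i) (crd i \o F) l (partial k (crd i \o F)) q.
  exact: (cov_tangentC (@image_open _ _ _ i) sG oU (sF i) yO).
have alE q k l : (D `&` F @^-1` dom i) q ->
    inner h F i q (nabla h F k (tangent F l) i q) (N1 i q) = E q * al k l q
    /\ inner h F i q (nabla h F k (tangent F l) i q) (N2 i q) = E q * be k l q.
  move=> Uq; have [Dq Fq] := Uq; have [s1 s2 s3] := hsigma Dq Fq.
  have key a b (a' b' : R) : normal_part h F (nabla h F a (tangent F b)) i q =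
      a' *: N1 i q + b' *: N2 i q ->
      inner h F i q (nabla h F a (tangent F b) i q) (N1 i q) = E q * a' /\
      inner h F i q (nabla h F a (tangent F b) i q) (N2 i q) = E q * b'.
    move=> H; rewrite -(inner_normal_part (nabla h F a (tangent F b)) Dq Fq (fun k => n1' q k Uq)).
    by rewrite -(inner_normal_part (nabla h F a (tangent F b)) Dq Fq (fun k => n2' q k Uq)) H comb1// comb2.
  have swap : nabla h F vv (tangent F uu) i q = nabla h F uu (tangent F vv) i q.
    exact: tanC.
  move: k l; apply: uv_case; apply: uv_case; rewrite /symmetric_array /=.
  - exact: key.
  - exact: key.
  - by rewrite swap; exact: key.
  - exact: key.
split.
- exact: image_open.
- exact: Defs.metric_smooth.
- exact: sG.
- by move=> x v [z iz <-]; exact: Defs.metric_pos.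
- exact: oU.
- exact: sF.
- exact: yO.
- by move=> r; apply: class_C_subset (slam r) => q [].
- by move=> q k l [Dq Fq]; exact: inner_tangent.
- exact: sN1.
- exact: sN2.
- exact: n1.
- exact: n2.
- by move=> q [Dq Fq]; have [] := nn i q Dq Fq.
- by move=> q [Dq Fq]; have [] := nn i q Dq Fq.
- by move=> q [Dq Fq]; have [] := nn i q Dq Fq.
- by move=> q k l Uq; have [] := alE q k l Uq.
- by move=> q k l Uq; have [] := alE q k l Uq.
- move=> q k Uq; have [Dq Fq] := Uq; have [m1 _ m2 _] := hmu Dq Fq.
  have key a (a' b' : R) : nabla_perp h F a N1 i q = a' *: N1 i q + b' *: N2 i q ->
      inner h F i q (nabla h F a N1 i q) (N2 i q) = E q * b'.
    by move=> H; rewrite -(inner_normal_part (nabla h F a N1) Dq Fq (fun k => n2' q k Uq)) [normal_part _ _ _ _ _]H comb2.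
  by move: k; apply: uv_case; rewrite /uv_pair /=; [exact: key m1|exact: key m2].
Qed.

Hypothesis hflat : flat_normal_connection h F D.

(** Flatness is applied to N1; the normal derivatives of N1 are combinations of N1
    and N2 on a neighborhood, so they can be differentiated again. In the component
    along N2 the terms containing lam cancel. *)
Lemma normal_connection_closed i q : D q -> dom i (F q) ->
  partial uu mu2 q = partial vv mu1 q.
Proof.
move=> Dq Fq; have fs := chart_framed_surface i; have Uq : (D `&` F @^-1` dom i) q by [].
have [nN1 _ _] := hN12; have slam := fs_lam_smooth fs.
have dl k : differentiable (partial k lam) q := smooth_diff (smooth_partial k slam) Uq.
have dm k : differentiable (mu k) q := smooth_diff (smooth_mu fs k) Uq.
have Tn2 k : inner h F i q (tangent F k i q) (N2 i q) = 0.
  by rewrite -(fs_normal2 fs k Uq); exact: (ipC fs).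
have step a b : inner h F i q (nabla_perp h F a (nabla_perp h F b N1) i q) (N2 i q) =
    E q * (partial a (mu b) q + mu b q * partial a lam q + partial b lam q * mu a q).
  rewrite [LHS](inner_normal_part (nabla h F a (nabla_perp h F b N1)) Dq Fq Tn2).
  rewrite -(cov_normal2 fs Uq (dl b) (dm b) a); congr (dot _ _ _).
  apply: cov_near; apply: (open_near_eq (fs_openU fs)) Uq => z [Dz Fz].
  have [m1 _ m2 _] := hmu Dz Fz.
  by move: b; apply: uv_case; rewrite /normal_combination /uv_pair /=; [exact: m1|exact: m2].
have := congr1 (fun v => inner h F i q v (N2 i q)) (hflat nN1 Dq Fq).
rewrite [X in _ = X](_ : _ = 0); last by rewrite /inner /dot !mul0mx mxE.
move=> H; have := etrans (congr2 (fun s t => s - t) (esym (step uu vv)) (esym (step vv uu)))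
  (etrans (esym (dotBl _ _ _ _)) H).
rewrite /uv_pair /= => /eqP; rewrite -mulrBr mulf_eq0 gt_eqF ?expR_gt0//= => /eqP.
move: (partial uu mu2 q) (partial vv mu1 q) (partial uu lam q) (partial vv lam q).
by move=> x1 x2 x3 x4; lra.
Qed.

(** The ball is taken inside the domain of one chart, where smoothness of the
    connection form can be read off from its expression in coordinates. *)
Lemma local_potential p : D p -> exists i (U : set 'rV[R]_2) gam,
  [/\ open U, U p, U `<=` D `&` F @^-1` dom i & potential U mu1 mu2 gam].
Proof.
move=> Dp; have [i ip] := dom_cover (F p); have fs := chart_framed_surface i.
have /nbhs_ballP[r /= r0 sub] := open_nbhs_nbhs (conj (fs_openU fs) (conj Dp ip)).
pose U : set 'rV[R]_2 := ball p r.
have oU : open U by exact: ball_open.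
have smu k : smooth U (mu k).
  by move=> n; exact: class_C_subset (smooth_mu fs k n).
have closed_mu (k l : 'I_2) x : U x -> partial k (mu l) x = partial l (mu k) x.
  move=> /sub[Dx Fx]; have C := normal_connection_closed Dx Fx.
  by move: k l; apply: uv_case; apply: uv_case; rewrite /uv_pair /=.
have dgam x : U x -> differentiable (primitive mu p) x.
  exact: (primitive_differentiable (fun k => smu k 1%N) closed_mu).
have pgam k x : U x -> partial k (primitive mu p) x = mu k x.
  exact: (partial_primitive (fun k => smu k 1%N) closed_mu).
exists i, U, (primitive mu p); split=> //; first exact: ballxx.
split=> [n|x Ux]; last by split; apply: pgam.
case: n => [x Ux|n]; first exact: differentiable_continuous (dgam x Ux).
split=> // k; apply: (class_C_ext oU) (smu k n) => x Ux.
by apply/esym; exact: pgam.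
Qed.

Section on_a_domain.
Variables (V : set 'rV[R]_2) (gam : 'rV[R]_2 -> R).
Hypothesis openV : open V.
Hypothesis connV : connected V.
Hypothesis VD : V `<=` D.
Hypothesis hgam : potential V mu1 mu2 gam.

Let fsV i : framed_surface (h i) (crd i @` dom i) (V `&` F @^-1` dom i) (crd i \o F) lam
    (N1 i) (N2 i) al be mu.
Proof.
apply: (fs_subset (chart_framed_surface i)); first exact: open_chart_preimage.
by move=> q [Vq Fq]; split=> //; exact: VD.
Qed.

Lemma linearly_dependentP theta :
  linearly_dependent V al1 al2 al3 be1 be2 be3 theta <->
  smooth V theta /\ forall q, V q -> degenerate_direction al be theta q.
Proof.
split=> -[sth dep]; split=> // q Vq.
  by have [d1 d2 d3] := dep q Vq; apply: uv_case; apply: uv_case; rewrite /symmetric_array /=.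
by split; [exact: (dep q Vq uu uu)|exact: (dep q Vq uu vv)|exact: (dep q Vq vv vv)].
Qed.

Let dgam q : V q -> differentiable gam q := smooth_diff hgam.1.

Let pgam k q : V q -> partial k gam q = mu k q.
Proof. by move=> Vq; have [g1 g2] := hgam.2 q Vq; move: k; exact: uv_case. Qed.

Lemma constant_angleP theta : smooth V theta -> V !=set0 ->
  constant_on V (fun q => gam q + theta q) <->
  forall q k, V q -> partial k theta q + mu k q = 0.
Proof.
move=> sth [p Vp]; have dth q : V q -> differentiable theta q := smooth_diff sth.
have pE q k : V q -> partial k (fun q => gam q + theta q) q = partial k theta q + mu k q.
  by move=> Vq; rewrite (partialD k (dgam Vq) (dth q Vq)) (pgam k Vq) addrC.
split=> [[c gc] q k Vq|w0].
  rewrite -(pE q k Vq) -(partial_cst k c q).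
  by apply: partial_near; apply: (open_near_eq openV) Vq.
exists (gam p + theta p) => q Vq.
apply: (constant_of_partial0 (f := fun q => gam q + theta q) openV connV) => // z.
  by move=> Vz; exact: differentiableDf (dgam Vz) (dth z Vz).
by move=> k Vz; rewrite (pE z k Vz) w0.
Qed.

Definition unit_normal_field (theta : 'rV[R]_2 -> R) : field N :=
  fun i => unit_normal lam (N1 i) (N2 i) theta.

Lemma unit_normal_field_change theta i j q : V q -> dom i (F q) -> dom j (F q) ->
  unit_normal_field theta j q =
  'd (crd j \o param i) (crd i (F q)) (unit_normal_field theta i q).
Proof.
move=> Vq iq jq; have [[[_ t1] _] [[_ t2] _] _] := hN12.
rewrite /unit_normal_field /unit_normal /normal_combination linearD !linearZ /=.
by rewrite -(t1 i j q (VD Vq) iq jq) -(t2 i j q (VD Vq) iq jq).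
Qed.

(** In every chart the equations are those of a framed surface, with the same angle. *)
Lemma unit_normal_field_parallel theta : smooth V theta ->
  (forall q, V q -> degenerate_direction al be theta q) ->
  (forall q k, V q -> partial k theta q + mu k q = 0) ->
  parallel_normal_field h F V (unit_normal_field theta).
Proof.
move=> sth dep w0; split; last first.
  move=> i q Vq iq; have Vi : (V `&` F @^-1` dom i) q by [].
  split; first exact: (unit_normal_neq0 (fsV i)).
  move=> k; apply: (unit_normal_parallel (fsV i) Vi) => //.
  - exact: smooth_diff sth Vq.
  - exact: dep.
  - exact: w0.
split; last first.
  by move=> i q Vq iq k; exact: (unit_normal_tangent (fsV i)).
split=> [i|i j q]; last exact: unit_normal_field_change.
apply: (smooth_unit_normal (fsV i)) => r.
by apply: class_C_subset (sth r) => q [].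
Qed.

(** The angle is found in one chart that contains the image of V; the formula for
    the normalized field then passes to the other charts, because the coordinate
    changes are linear on vectors and isometric. *)
Lemma parallel_normal_angle i0 xi : V !=set0 -> V `<=` F @^-1` dom i0 ->
  parallel_normal_field h F V xi -> exists theta,
  [/\ smooth V theta, forall q, V q -> degenerate_direction al be theta q,
      constant_on V (fun q => gam q + theta q) &
      normalized_form h F V lam N1 N2 theta xi].
Proof.
move=> V0 Vi0 [[[sxi txi] nxi] pxi].
have VV : V `&` F @^-1` dom i0 = V by apply/setIidPl.
have fs := fsV i0; rewrite VV in fs.
have sxi0 := sxi i0; rewrite VV in sxi0.
have [|||||c [r [r0 H]]] := parallel_normal_unit fs (xi := xi i0) (gam := gam) connV V0 sxi0.
- by move=> q k Vq; apply: nxi => //; exact: Vi0.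
- by move=> q Vq; have [] := pxi i0 q Vq (Vi0 q Vq).
- by move=> q k Vq; have [_] := pxi i0 q Vq (Vi0 q Vq); apply.
- exact: hgam.1.
- by move=> q k Vq; exact: pgam.
exists (fun q => c - gam q); split.
- move=> n; apply: class_CD => //; first exact: class_C_cst.
  by apply: class_CN => //; exact: hgam.1.
- by move=> q Vq; have [] := H q Vq.
- by exists c => q _; rewrite addrC subrK.
move=> j q Vq jq; have iq := Vi0 q Vq; have [xiE _] := H q Vq.
have -> : inner h F j q (xi j q) (xi j q) = r ^+ 2.
  rewrite (txi i0 j q Vq iq jq) /inner metric_compat//.
  rewrite xiE dotZl dotZr [dot _ _ _](unit_normal_norm fs _ Vq) mulr1.
  by rewrite expr2.
rewrite sqrtr_sqr gtr0_norm// (txi i0 j q Vq iq jq) xiE linearZ scalerA mulVf ?gt_eqF//.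
rewrite scale1r -(unit_normal_field_change _ Vq iq jq).
by rewrite /unit_normal_field /unit_normal /normal_combination scalerDr !scalerA.
Qed.

End on_a_domain.

End charts.
Theorem theorem2p1 (R : realType) (N : manifold R 4) (h : riemannian_metric N)
    (L0 : R) (hN : constant_curvature h L0)
    (D : set 'rV[R]_2) (D_open : open D) (D_sc : @simply_connected R _ D)
    (F : 'rV[R]_2 -> N) (lam : 'rV[R]_2 -> R)
    (hF : conformal_immersion h F D lam)
    (N1 N2 : field N) (hN12 : normal_frame h F D lam N1 N2)
    (al1 al2 al3 be1 be2 be3 mu1 mu2 : 'rV[R]_2 -> R)
    (hsigma : second_fundamental_form h F D N1 N2 al1 al2 al3 be1 be2 be3)
    (hmu : normal_connection_form h F D lam N1 N2 mu1 mu2)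
    (hflat : flat_normal_connection h F D)
    (p : 'rV[R]_2) (Dp : D p) :
  exists (U : set 'rV[R]_2) (gamma : 'rV[R]_2 -> R),
    [/\ open U, U p, U `<=` D, potential U mu1 mu2 gamma &
    forall V : set 'rV[R]_2, open V -> connected V -> V p -> V `<=` U ->
      ((forall q, D q -> gauss_curvature lam q <> L0) ->
        [/\ (exists xi, parallel_normal_field h F V xi) <->
            (exists theta,
               linearly_dependent V al1 al2 al3 be1 be2 be3 theta),
            forall theta,
              linearly_dependent V al1 al2 al3 be1 be2 be3 theta ->
              constant_on V (fun q => gamma q + theta q) &
            forall xi, parallel_normal_field h F V xi ->
              exists theta,
                linearly_dependent V al1 al2 al3 be1 be2 be3 theta /\
                normalized_form h F V lam N1 N2 theta xi]) /\
      ((forall q, D q -> gauss_curvature lam q = L0) ->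
        ((exists xi, parallel_normal_field h F V xi) <->
         (exists theta,
            linearly_dependent V al1 al2 al3 be1 be2 be3 theta /\
            constant_on V (fun q => gamma q + theta q))) /\
        (forall xi, parallel_normal_field h F V xi ->
           exists theta,
             [/\ linearly_dependent V al1 al2 al3 be1 be2 be3 theta,
                 constant_on V (fun q => gamma q + theta q) &
                 normalized_form h F V lam N1 N2 theta xi]))].
Proof.
have [i [U [gam [oU Up UD hgam]]]] := local_potential D_open hF hN12 hsigma hmu hflat Dp.
exists U, gam; split=> //; first by move=> q /UD[].
move=> V oV cV Vp VU.
have VD : V `<=` D by move=> q /VU/UD[].
have Vi : V `<=` F @^-1` dom i by move=> q /VU/UD[].
have V0 : V !=set0 by exists p.
have hgamV : potential V mu1 mu2 gam.
  split=> [r|q Vq]; first exact: class_C_subset (hgam.1 r).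
  exact: hgam.2 q (VU q Vq).
have lin theta := linearly_dependentP al1 al2 al3 be1 be2 be3 V theta.
have const := constant_angleP oV cV hgamV.
have par := parallel_normal_angle D_open hF hN12 hsigma hmu oV cV VD hgamV V0 Vi.
have unitp := unit_normal_field_parallel D_open hF hN12 hsigma hmu oV VD.
split=> K.
- have fs := fs_subset (chart_framed_surface D_open hF hN12 hsigma hmu i) oV
    (fun q Vq => conj (VD q Vq) (Vi q Vq)).
  have constG x X Y : (@Defs.coord R 4 N i @` dom i) x -> row_free (col_mx X Y) ->
      sectional_curvature (h i) x X Y = L0.
    by move=> [z iz <-]; exact: hN.
  have w0 theta : linearly_dependent V al1 al2 al3 be1 be2 be3 theta ->
      forall q k, V q -> partial k theta q + uv_pair mu1 mu2 k q = 0.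
    move=> /lin[sth dep] q k Vq.
    exact: (degenerate_angle fs constG k sth dep Vq (K q (VD q Vq))).
  split.
  + split=> [[xi pxi]|[theta dth]].
      by have [theta [sth dep _ _]] := par xi pxi; exists theta; exact/lin.
    exists (unit_normal_field lam N1 N2 theta); have [sth dep] := (lin theta).1 dth.
    by apply: unitp => //; exact: w0.
  + move=> theta dth; have [sth _] := (lin theta).1 dth.
    by apply/(const theta sth V0); exact: w0.
  + move=> xi pxi; have [theta [sth dep _ nf]] := par xi pxi.
    by exists theta; split=> //; exact/lin.
- split.
  + split=> [[xi pxi]|[theta [dth cth]]].
      by have [theta [sth dep cth _]] := par xi pxi; exists theta; split=> //; exact/lin.
    exists (unit_normal_field lam N1 N2 theta); have [sth dep] := (lin theta).1 dth.
    by apply: unitp => //; apply/(const theta sth V0).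
  + move=> xi pxi; have [theta [sth dep cth nf]] := par xi pxi.
    by exists theta; split=> //; exact/lin.
Qed.
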